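(* Let $\Theta\subseteq\mathbb R^d$ be open, and for $\boldsymbol\theta\in\Theta$ let $P_{\boldsymbol\theta}^{(n)}$ be the distribution of the sample $\mathbf X=(X_1,\ldots,X_n)\in\mathcal X^n$, with likelihood $p_n(\mathbf x\mid\boldsymbol\theta)$ and expected $n$-sample Fisher information matrix $J_n(\boldsymbol\theta)$. Let $K\subset\Theta$ be compact, and let $\pi$ be a probability density on $K$ ($\int_K\pi(\boldsymbol\theta)\,d\boldsymbol\theta=1$) that is continuous and strictly positive on $K$. Put $r_n(\mathbf x)=\int_K p_n(\mathbf x\mid\boldsymbol\theta)\pi(\boldsymbol\theta)\,d\boldsymbol\theta$ and $\Pi(W)=\int_W\pi(\boldsymbol\vartheta)\,d\boldsymbol\vartheta$. Consider a sequence of codebooks $\mathcal C_n=(\mathcal P_n,q_n,\boldsymbol\theta_n)$, where $\mathcal P_n=\{P_{n,1},\ldots,P_{n,k_n}\}$ is a finite measurable partition of $\mathcal X^n$, $q_n=\{q_{n,1},\ldots,q_{n,k_n}\}$ with $q_{n,j}=r_n(P_{n,j})>0$ for all $n,j$, and $\boldsymbol\theta_n=\{\boldsymbol\theta_{n,1},\ldots,\boldsymbol\theta_{n,k_n}\}\subset K$, where $\boldsymbol\theta_{n,j}$ is the (quantised) assertion used for all data in $P_{n,j}$. For data $\mathbf x\in P_{n,j}$ let $T_n(\mathbf x)\in K$ denote the corresponding unquantised local parameter estimate. Assume: (A1) $J_n(\boldsymbol\theta)$ is continuous and positive definite on $K$, and $\inf_{\boldsymbol\theta\in K}\lambda_{\min}\{J_n(\boldsymbol\theta)\}\to\infty$.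 (A2) For every bounded set $B\subset\mathbb R^d$, $$\sup_{\boldsymbol\theta\in K,\ \mathbf u\in B}\left|D_{\mathrm{KL}}\!\left(P^{(n)}_{\boldsymbol\theta+J_n(\boldsymbol\theta)^{-1/2}\mathbf u}\,\Vert\,P^{(n)}_{\boldsymbol\theta}\right)-\tfrac12\|\mathbf u\|^2\right|\to0 .$$ (A3) Each data-space cell $P_{n,j}$ induces a region $W_{n,j}\subset K$, interpreted as the set of unquantised local parameter values $T_n(\mathbf x)$ assigned to the assertion $\boldsymbol\theta_{n,j}$, such that $q_{n,j}=\Pi(W_{n,j})\exp(\alpha_{n,j})$ with $\sum_j q_{n,j}|\alpha_{n,j}|\to0$. Moreover $W_{n,j}=\{\boldsymbol\theta_{n,j}+J_n(\boldsymbol\theta_{n,j})^{-1/2}\mathbf u:\mathbf u\in C_{n,j}\}$, where $C_{n,j}\subset\mathbb R^d$ is measurable, contains the origin, has positive volume $V_{n,j}=\operatorname{Vol}(C_{n,j})$, and the sets $C_{n,j}$ have uniformly bounded diameter. (A4) With $$\Delta_{n,j}=\mathbb E_{r_n}\left[-\log p_n(\mathbf X\mid\boldsymbol\theta_{n,j})+\log p_n\{\mathbf X\mid T_n(\mathbf X)\}\,\middle|\,\mathbf X\in P_{n,j}\right],$$ one has $$\Delta_{n,j}=\frac1{\Pi(W_{n,j})}\int_{W_{n,j}}D_{\mathrm{KL}}\!\left(P^{(n)}_{\boldsymbol\vartheta}\,\Vert\,P^{(n)}_{\boldsymbol\theta_{n,j}}\right)\pi(\boldsymbol\vartheta)\,d\boldsymbol\vartheta+\varepsilon_{n,j},\qquad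 \sum_j q_{n,j}|\varepsilon_{n,j}|\to0 .$$ (A5) With $\Phi(C)=-\log V(C)+\frac1{2V(C)}\int_C\|\mathbf u\|^2\,d\mathbf u$ and $\kappa_d$ the optimal $d$-dimensional normalised second-moment constant, $$\sum_j q_{n,j}\Phi(C_{n,j})=\frac d2\log\kappa_d+\frac d2+o(1).$$ (A6) With $\varphi_n(\boldsymbol\theta)=-\log\pi(\boldsymbol\theta)+\frac12\log|J_n(\boldsymbol\theta)|$, $$\sum_j q_{n,j}\varphi_n(\boldsymbol\theta_{n,j})=\int_K\varphi_n(\boldsymbol\theta)\pi(\boldsymbol\theta)\,d\boldsymbol\theta+o(1).$$ Let $\mathcal I_n^{\mathrm{ASMML}}$ denote the expected codelength of the codebook $\mathcal C_n$. Then, as $n\to\infty$, $$\mathcal I_n^{\mathrm{ASMML}}=\mathbb E_{r_n}\left[-\log p_n\{\mathbf X\mid T_n(\mathbf X)\}\right]+h(\pi)+\frac12\int_K\pi(\boldsymbol\theta)\log|J_n(\boldsymbol\theta)|\,d\boldsymbol\theta+\frac d2\log\kappa_d+\frac d2+o(1),$$ where $h(\pi)=-\int_K\pi(\boldsymbol\theta)\log\pi(\boldsymbol\theta)\,d\boldsymbol\theta$. In particular, if the model is i.i.d. and $J_n(\boldsymbol\theta)=nI(\boldsymbol\theta)$, then $$\mathcal I_n^{\mathrm{ASMML}}=\mathbb E_{r_n}\left[-\log p_n\{\mathbf X\mid T_n(\mathbf X)\}\right]+\frac d2\log n+h(\pi)+\frac12\int_K\pi(\boldsymbol\theta)\log|I(\boldsymbol\theta)|\,d\boldsymbol\theta+\frac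 d2\log\kappa_d+\frac d2+o(1).$$
   Context: Expected codelength: for a codebook $\mathcal C_n=(\mathcal P_n,q_n,\boldsymbol\theta_n)$, data $\mathbf x\in P_{n,j}$ are encoded with length $-\log q_{n,j}-\log p_n(\mathbf x\mid\boldsymbol\theta_{n,j})$, and the expected two-part codelength under $r_n$ is $$\mathcal I_n^{\mathrm{ASMML}}=-\sum_{j}q_{n,j}\log q_{n,j}-\sum_j\sum_{\mathbf x\in P_{n,j}}r_n(\mathbf x)\log p_n(\mathbf x\mid\boldsymbol\theta_{n,j}),$$ with sums over $\mathbf x$ interpreted as integrals in the continuous case; likewise $r_n(P)=\sum_{\mathbf x\in P}r_n(\mathbf x)$. $\mathbb E_{r_n}$ is expectation when $\mathbf X$ has density $r_n$. $|M|$ is the determinant of a matrix $M$, $\lambda_{\min}$ the smallest eigenvalue, and $J^{-1/2}$ the inverse of the symmetric positive definite square root. $D_{\mathrm{KL}}(P\Vert Q)$ is the Kullback--Leibler divergence. $I(\boldsymbol\theta)$ is the per-observation Fisher information matrix. Quantisation constants: for a Fisher-normalised cell $C\subset\mathbb R^d$ (measurable, containing the origin, bounded, of positive volume) write $V(C)=\operatorname{Vol}(C)$ and define its normalised second moment by $$\kappa(C)=\frac1{d\,V(C)^{1+2/d}}\int_C\|\mathbf u\|^2\,d\mathbf u,$$ which satisfies $\kappa(aC)=\kappa(C)$ for $a>0$. The optimal $d$-dimensional normalised second-moment constant is $\kappa_d=\inf_C\kappa(C)$. *)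

(* Defs.v *)
From HB Require Import structures.
From mathcomp Require Import all_boot all_order all_algebra.
From mathcomp Require Import all_classical all_reals all_analysis.

Set Implicit Arguments.
Unset Strict Implicit.
Unset Printing Implicit Defensive.

Import Order.TTheory GRing.Theory Num.Theory.
Import numFieldNormedType.Exports.

Local Open Scope classical_set_scope.
Local Open Scope ring_scope.

(* R^d is ['cV[R]_d], with the sigma-algebra generated by the coordinates,
   that is, the Borel sigma-algebra. *)
Definition cvector_display : measure_display. Proof. exact. Qed.

Section cvector_measurable.
Variables (R : realType) (n : nat).

Definition cvector_gen : set (set 'cV[R]_n) :=
  [set A | exists (i : 'I_n) (B : set R),
    measurable B /\ A = [set u : 'cV[R]_n | B (u i ord0)]].

Let cv_set0 : <<s cvector_gen >> set0.
Proof. exact: sigma_algebra0. Qed.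

Let cv_setC A : <<s cvector_gen >> A -> <<s cvector_gen >> (~` A).
Proof. exact: sigma_algebraC. Qed.

Let cv_bigcup (F : (set 'cV[R]_n)^nat) :
  (forall i, <<s cvector_gen >> (F i)) -> <<s cvector_gen >> (\bigcup_i (F i)).
Proof. exact: sigma_algebra_bigcup. Qed.

HB.instance Definition _ := @isMeasurable.Build cvector_display
  'cV[R]_n <<s cvector_gen >> cv_set0 cv_setC cv_bigcup.

End cvector_measurable.

(* The d-dimensional Lebesgue measure is the d-fold product of the Lebesgue
   measure of the real line; [cvector_cons (u, t)] is (t, u_1, ..., u_d). *)
Definition cvector_cons (R : realType) n (ut : 'cV[R]_n * R) : 'cV[R]_n.+1 :=
  \col_i (if unlift ord0 i is Some j then ut.1 j ord0 else ut.2).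

Lemma measurable_cvector_cons (R : realType) n :
  measurable_fun setT (@cvector_cons R n).
Proof.
apply: (@measurability _ _ _ _ setT (@cvector_cons R n) (@cvector_gen R n.+1)) => //.
move=> _ [_ [i [B [mB ->]]] <-].
case: (unliftP ord0 i) => [j|] ->.
- have -> : [set: 'cV[R]_n * R] `&` @cvector_cons R n @^-1`
        [set u : 'cV[R]_n.+1 | B (u (lift ord0 j) ord0)]
      = setT `&` fst @^-1` [set u : 'cV[R]_n | B (u j ord0)].
    by rewrite !setTI; apply/funext => -[u t] /=; rewrite mxE liftK.
  apply: measurable_fst => //; apply: sub_sigma_algebra.
  by exists j, B.
- have -> : [set: 'cV[R]_n * R] `&` @cvector_cons R n @^-1`
        [set u : 'cV[R]_n.+1 | B (u ord0 ord0)] = setT `&` snd @^-1` B.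
    by rewrite !setTI; apply/funext => -[u t] /=; rewrite mxE unlift_none.
  exact: measurable_snd.
Qed.

Section lebesgue_cons.
Local Open Scope ereal_scope.
Variables (R : realType) (n : nat) (m : {measure set 'cV[R]_n -> \bar R}).

Definition lebesgue_cons : set 'cV[R]_n.+1 -> \bar R :=
  pushforward (m \x @lebesgue_measure R) (@cvector_cons R n).

Let mu : {measure set 'cV[R]_n.+1 -> \bar R} :=
  @measure_function_pushforward__canonical__measure_function_Measure _ _ _ _ _
   (m \x @lebesgue_measure R)%E _ (@measurable_cvector_cons R n).
HB.instance Definition _ := Measure.copy lebesgue_cons mu.

End lebesgue_cons.

Fixpoint lebesgue_cv (R : realType) n : {measure set 'cV[R]_n -> \bar R} :=
  match n with
  | 0%N => @dirac _ 'cV[R]_0 0 R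
  | m.+1 => lebesgue_cons (lebesgue_cv R m)
  end.

Section linear_algebra.
Variables (R : realType) (d : nat).
Implicit Types (u : 'cV[R]_d) (M S : 'M[R]_d).

(* The library norm on matrices is the sup norm; this is the Euclidean one. *)
Definition sqnorm u : R := \sum_i u i ord0 ^+ 2.
Definition enorm u : R := Num.sqrt (sqnorm u).

Definition posdefmx M : Prop :=
  M^T = M /\ forall u, u != 0 -> 0 < (u^T *m M *m u) ord0 ord0.

(* The symmetric positive definite square root; 0 if there is none. *)
Definition spd_sqrtmx M : 'M[R]_d :=
  xget 0 [set S | posdefmx S /\ S *m S = M].

Definition inv_sqrtmx M : 'M[R]_d := invmx (spd_sqrtmx M).

Definition lambda_min M : R := inf [set a | eigenvalue M a].

End linear_algebra.

Section quantisation.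
Variables (R : realType) (d : nat).
Implicit Types C : set 'cV[R]_d.

Definition vol C : R := fine (lebesgue_cv R d C).

Definition fisher_cell C : Prop :=
  [/\ measurable C, C 0, bounded_set C & 0 < vol C].

Definition kappa C : R :=
  (d%:R * vol C `^ (1 + 2 / d%:R))^-1 *
  \int[lebesgue_cv R d]_(u in C) sqnorm u.

Definition kappa_opt : R := inf [set kappa C | C in fisher_cell].

Definition Phi C : R :=
  - ln (vol C) + (2 * vol C)^-1 * \int[lebesgue_cv R d]_(u in C) sqnorm u.

End quantisation.
Arguments kappa_opt : clear implicits.

Section divergence.
Local Open Scope ereal_scope.
Local Open Scope charge_scope.
Context dT (T : measurableType dT) (R : realType).
Implicit Types P Q : probability T R.

Definition KL P Q : \bar R :=
  if `[< P `<< Q >] then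
    \int[P]_x lne (('d (charge_of_finite_measure P) '/d Q) x)
  else +oo.

End divergence.

Record codebook dT (T : measurableType dT) (R : realType) (d : nat) := Codebook {
  ncells : nat;
  cell : 'I_ncells -> set T;
  weight : 'I_ncells -> R;
  assertion : 'I_ncells -> 'cV[R]_d }.
Arguments ncells {dT T R d} _.
Arguments cell {dT T R d} _ _.
Arguments weight {dT T R d} _ _.
Arguments assertion {dT T R d} _ _.

Section model.
Context dT (T : measurableType dT) (R : realType) (d : nat).
Implicit Types (nu : {measure set T -> \bar R}) (Q : probability T R).
Implicit Types (p : 'cV[R]_d -> T -> R) (theta : 'cV[R]_d).

(* [nu] is the reference measure of the likelihoods: counting measure in the
   discrete case, Lebesgue measure in the continuous one. *)
Definition has_density nu Q (f : T -> R) : Prop :=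
  [/\ measurable_fun setT f, forall x, 0 <= f x &
      forall A, measurable A -> Q A = (\int[nu]_(x in A) (f x)%:E)%E].

(* [s i] is the partial derivative of the log-likelihood along e_i, which is only
   required to exist almost surely. *)
Definition is_score Q p theta (s : 'I_d -> T -> R) : Prop :=
  forall i, measurable_fun setT (s i) /\
    {ae Q, forall x,
      is_derive (0 : R) 1
        (fun t : R => ln (p (theta + t *: delta_mx i ord0) x)) (s i x)}.

Definition is_fisher_information Q p theta (M : 'M[R]_d) : Prop :=
  exists2 s : 'I_d -> T -> R, is_score Q p theta s &
    forall i j,
      Q.-integrable setT (fun x => (s i x * s j x)%:E) /\
      M i j = (\int[Q]_x (s i x * s j x))%R.

Definition mixture p (K : set 'cV[R]_d) (pi : 'cV[R]_d -> R) (x : T) : \bar R :=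
  (\int[lebesgue_cv R d]_(theta in K) (p theta x * pi theta)%:E)%E.

(* [neglog (p theta) x] is +oo where the likelihood vanishes. *)
Definition neglog (f : T -> R) (x : T) : \bar R := (- lne (f x)%:E)%E.

(* [r x * f x] is 0 wherever [r x = 0], even if [f x] is infinite. *)
Definition expect nu (r f : T -> \bar R) : \bar R :=
  (\int[nu]_x (r x * f x))%E.

Definition cond_expect nu (r f : T -> \bar R) (A : set T) : \bar R :=
  ((\int[nu]_(x in A) r x)^-1 * \int[nu]_(x in A) (r x * f x))%E.

Definition measurable_partition k (A : 'I_k -> set T) : Prop :=
  [/\ forall j, measurable (A j), trivIset setT A & \bigcup_j A j = setT].

(* The minus sign is inside the integrals so that a cell on which the codelength
   has integral +oo is not absorbed by the convention +oo - oo = -oo. *)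
Definition codelength nu p (r : T -> \bar R) (B : codebook T R d) : \bar R :=
  ((- \sum_j weight B j * ln (weight B j))%:E +
   \sum_j \int[nu]_(x in cell B j) (r x * neglog (p (assertion B j)) x))%E.

End model.

Definition iid_law dX (X : measurableType dX) (R : realType) n
    (P : probability (n.-tuple X) R) (Q : probability X R) : Prop :=
  forall A : 'I_n -> set X, (forall i, measurable (A i)) ->
    P [set x | forall i, A i (tnth x i)] = (\prod_i Q (A i))%E.

(* Main.v *)
(* On a cell, the prior is constant up to a factor tending to 1, by uniform
   continuity and because lambda_min(J_n) -> oo shrinks the cells; the linear change
   of variables u |-> theta_j + J_n^{-1/2} u then gives
     log Pi(W_j) = log pi(theta_j) - 1/2 log |J_n(theta_j)| + log V_j + o(1)
   and, with (A2), Delta_j = 1/(2 V_j) int_{C_j} |u|^2 du + eps_j + o(1), uniformly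
   in j. Hence Delta_j - log q_j = Phi(C_j) + phi_n(theta_j) + eps_j - alpha_j + o(1),
   and averaging over q_j, with (A3)-(A6), gives the expansion. Since the expected
   codelength may be infinite, the identity
     I_n = E[-log p_n(X | T_n)] + sum_j q_j (Delta_j - log q_j)
   is proved for extended integrals: on each cell the difference of the two
   integrands is integrable even if neither of them is. *)
Require Import Defs.
From HB Require Import structures.
From mathcomp Require Import all_boot all_order all_algebra.
From mathcomp Require Import all_classical all_reals all_analysis.
From mathcomp Require Import measurable_realfun.
From mathcomp Require polyrcf.
From mathcomp Require Import ring lra.
Import Order.TTheory GRing.Theory Num.Theory.
Import numFieldNormedType.Exports.
Local Open Scope classical_set_scope.
Local Open Scope ring_scope.

(** The symmetric root in [inv_sqrtmx] is a choice with default [0]. Its existence is not proved;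
    the default is excluded cell by cell: it would collapse [W_j] to a point, a null set as [d > 0],
    whereas [q_j > 0] and [q_j = Pi(W_j) exp(alpha_j)] give [W_j] positive prior mass. The change of
    variables has to be proved for [lebesgue_cv], an iterated product. Elimination reduces it to
    block triangular maps, on which Fubini's theorem separates one coordinate from the others.
    Uniformity in [j] comes from one ball: the common diameter bound and the origin in each [C_j]
    put all of them inside it. That ball is the bounded set used in (A2), and its radius divided by
    the root of the smallest eigenvalue bounds the radius of every [W_j]. A uniform error on the
    cells survives averaging because the weights sum to 1, a consequence of Tonelli's theorem for
    the mixture. *)

(** * Quadratic forms, determinants and the smallest eigenvalue *)

(** The expression is [c t^2 - 2 s t], left in the shape in which expanding a bilinear form produces
    it. At [t = s / (1 + c)] it equals [- t s - t^2]; unlike the minimiser [s / c], this point also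
    makes sense for [c = 0]. *)
Lemma quadratic_ge0_linear_eq0 (R : realType) (s c : R) : 0 <= s -> 0 <= c ->
  (forall t, 0 <= - t * s + (- t * s + - t * (- t * c))) -> s = 0.
Proof.
move=> s0 c0 /(_ (s / (1 + c))); set t := s / (1 + c).
have tc : t * (1 + c) = s by rewrite mulfVK//; lra.
have t0 : 0 <= t by rewrite divr_ge0//; lra.
have ts : 0 <= t * s by rewrite mulr_ge0.
have -> : - t * s + (- t * s + - t * (- t * c)) =
  - (t * s) - (t * s - t * (t * (1 + c))) - t ^+ 2 by ring.
rewrite tc => h; have : t ^+ 2 == 0 by rewrite eq_le sqr_ge0 andbT; lra.
by rewrite sqrf_eq0 => /eqP t_eq0; rewrite -tc t_eq0 mul0r.
Qed.

Section quadratic_forms.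
Context {R : realType} {d : nat}.
Implicit Types (u : 'cV[R]_d) (M S : 'M[R]_d).

Let form M (v w : 'rV[R]_d) : R := (v *m M *m w^T) ord0 ord0.

Lemma sqnormE u : sqnorm u = (u^T *m u) ord0 ord0.
Proof. by rewrite mxE; apply: eq_bigr => i _; rewrite mxE expr2. Qed.

Lemma sqnorm_ge0 u : 0 <= sqnorm u.
Proof. by apply: sumr_ge0 => i _; exact: sqr_ge0. Qed.

Lemma sqnorm_eq0 u : (sqnorm u == 0) = (u == 0).
Proof.
apply/eqP/eqP => [/eqP|->]; last by rewrite sqnormE mulmx0 mxE.
rewrite psumr_eq0 => [/allP u0|i _]; last exact: sqr_ge0.
apply/colP => i; rewrite mxE; apply/eqP; rewrite -sqrf_eq0.
by apply: u0; rewrite mem_index_enum.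
Qed.

Lemma sqnormZ a u : sqnorm (a *: u) = a ^+ 2 * sqnorm u.
Proof.
rewrite /sqnorm mulr_sumr; apply: eq_bigr => i _.
by rewrite mxE exprMn.
Qed.

Lemma normr_le_entry u i : `|u i ord0| <= enorm u.
Proof.
rewrite /enorm -sqrtr_sqr ler_wsqrtr// /sqnorm (bigD1 i)//= lerDl.
by apply: sumr_ge0 => k _; exact: sqr_ge0.
Qed.

Lemma normr_le_enorm u : `|u| <= enorm u.
Proof.
rewrite [leLHS]/Num.norm /= mx_normrE; apply/bigmax_leP; split=> [|[i j] _ /=].
  exact: sqrtr_ge0.
by rewrite ord1; exact: normr_le_entry.
Qed.

Lemma posdefmx_eigenvalue_gt0 {M} {a : R} :
  posdefmx M -> eigenvalue M a -> 0 < a.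
Proof.
move=> [_ Mpos] /eigenvalueP[v vM v0].
have vT0 : v^T != 0 by rewrite trmx_eq0.
have := Mpos _ vT0; rewrite trmxK vM -scalemxAl mxE pmulr_lgt0//.
rewrite lt_neqAle; have -> : (v *m v^T) ord0 ord0 = sqnorm v^T.
  by rewrite sqnormE trmxK.
by rewrite eq_sym sqnorm_eq0 vT0 sqnorm_ge0.
Qed.

Lemma posdefmx_det_gt0 M : posdefmx M -> 0 < \det M.
Proof.
move=> Mpos; pose q := char_poly (- M).
have q0 : q.[0] = \det M.
  rewrite -[M in RHS]opprK -[- - M]scaleN1r detZ horner_coef0.
  exact: char_poly_det.
rewrite ltNge; apply/negP => detM.
have [b qb] : exists b, forall x, b <= x -> 0 < q.[x].
  have lq : lead_coef q = 1 by exact/monicP/char_poly_monic.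
  have [|b qb] := @polyrcf.poly_pinfty_gt_lc _ q; first by rewrite lq.
  by exists b => x /qb; apply: lt_le_trans; rewrite lq.
have [||c /andP[c0 _] qc] := @poly_ivt R q 0 (Num.max 0 b).
- by rewrite le_max lexx.
- by rewrite q0 detM ltW// qb// le_max lexx orbT.
have : eigenvalue (- M) c by rewrite eigenvalue_root_char.
move=> /eigenvalueP[v vM v0].
have : eigenvalue M (- c).
  by apply/eigenvalueP; exists v => //; rewrite scaleNr -vM mulmxN opprK.
by move=> /(posdefmx_eigenvalue_gt0 Mpos); rewrite oppr_gt0 ltNge c0.
Qed.

Let formE M (v w : 'rV[R]_d) :
  form M v w = \sum_j (\sum_i v ord0 i * M i j) * w ord0 j.
Proof. by rewrite /form mxE; apply: eq_bigr => j _; rewrite !mxE. Qed.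

Let formD1 M (v1 v2 w : 'rV[R]_d) : form M (v1 + v2) w = form M v1 w + form M v2 w.
Proof. by rewrite /form !mulmxDl mxE. Qed.

Let formD2 M (v w1 w2 : 'rV[R]_d) : form M v (w1 + w2) = form M v w1 + form M v w2.
Proof. by rewrite /form linearD mulmxDr mxE. Qed.

Let formZ1 M a (v w : 'rV[R]_d) : form M (a *: v) w = a * form M v w.
Proof. by rewrite /form -!scalemxAl mxE. Qed.

Let formZ2 M a (v w : 'rV[R]_d) : form M v (a *: w) = a * form M v w.
Proof. by rewrite /form linearZ -scalemxAr mxE. Qed.

Let formC M (v w : 'rV[R]_d) : M^T = M -> form M v w = form M w v.
Proof.
move=> MT; rewrite /form.
have -> : w *m M *m v^T = (v *m M *m w^T)^T by rewrite !trmx_mul trmxK MT mulmxA.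
by rewrite [in RHS]mxE.
Qed.

(* A minimum point of the quadratic form on the unit sphere is an eigenvector,
   for the form of M - mu I is nonnegative and vanishes there. *)
Lemma posdefmx_le_form M u : posdefmx M ->
  lambda_min M * sqnorm u <= (u^T *m M *m u) ord0 ord0.
Proof.
move=> Mpos; have [MT _] := Mpos.
have [->|u0] := eqVneq u 0; first by rewrite sqnormE !mulmx0 mxE mulr0.
pose A := [set v : 'rV[R]_d | sqnorm v^T = 1].
have sqn (v : 'rV[R]_d) : sqnorm v^T = form 1%:M v v by rewrite sqnormE /form mulmx1 trmxK.
have cont (N : 'M[R]_d) : continuous (fun v : 'rV[R]_d => form N v v).
  move=> v; under eq_fun do rewrite formE.
  apply: (@cvg_big R^o _ +%R 0 xpredT _ _ (nbhs v)) => [|j _]; first exact: add_continuous.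
  apply: cvgM; last exact: coord_continuous.
  apply: (@cvg_big R^o _ +%R 0 xpredT _ _ (nbhs v)) => [|i _]; first exact: add_continuous.
  by apply: cvgMl; exact: coord_continuous.
have Anorm (w : 'rV[R]_d) : w != 0 -> A ((Num.sqrt (sqnorm w^T))^-1 *: w).
  move=> w0; rewrite /A /= linearZ sqnormZ exprVn sqr_sqrtr ?sqnorm_ge0// mulVf//.
  by rewrite sqnorm_eq0 trmx_eq0.
have A0 : A !=set0 by eexists; apply: (Anorm u^T); rewrite trmx_eq0.
have cA : compact A.
  apply: bounded_closed_compact.
    exists 1; split => // x x1 v vA; apply: (le_trans _ (ltW x1)).
    rewrite [leLHS]/Num.norm /= mx_normrE; apply/bigmax_leP; split=> // -[i j] _ /=.
    rewrite (ord1 i); have := normr_le_entry v^T j; rewrite mxE.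
    by rewrite /enorm (_ : sqnorm v^T = 1)// sqrtr1.
  have -> : A = (fun v : 'rV[R]_d => form 1%:M v v) @^-1` [set 1 : R].
    by apply/funext => v; rewrite /A /= sqn.
  by apply: preimage_closed; [move=> v _; exact: cont|exact: closed_eq].
have [|v + vmin] := @EVT_min_rV R d (fun v : 'rV[R]_d => form M v v) A A0 cA.
  by apply: continuous_subspaceT => x; exact: cont.
rewrite inE => Av; pose mu := form M v v.
pose N : 'M[R]_d := M - mu%:M.
have NE (v1 v2 : 'rV[R]_d) : form N v1 v2 = form M v1 v2 - mu * form 1%:M v1 v2.
  rewrite /form /N mulmxBr mulmxBl mxE [X in _ + X]mxE; congr (_ - _).
  by rewrite mulmx1 mul_mx_scalar -scalemxAl mxE.
have NT : N^T = N by rewrite /N linearB/= MT tr_scalar_mx.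
have N0 (w : 'rV[R]_d) : 0 <= form N w w.
  have [->|w0] := eqVneq w 0; first by rewrite /form !mul0mx mxE.
  have wT0 : 0 < sqnorm w^T by rewrite lt_neqAle sqnorm_ge0 eq_sym sqnorm_eq0 trmx_eq0 w0.
  have := vmin _ (mem_set (Anorm w w0)); rewrite -/mu formZ1 formZ2 mulrA -invfM.
  rewrite -expr2 sqr_sqrtr ?sqnorm_ge0// ler_pdivlMl// mulrC.
  by rewrite NE subr_ge0 -sqn.
have Nv : form N v v = 0 by rewrite NE -sqn Av mulr1 subrr.
have vN : v *m N = 0.
  (* The form of [N] is nonnegative along the line [v - t z] and vanishes at [t = 0], so its linear
     coefficient must vanish; for [z = v N] that coefficient is, up to a factor, the squared norm of
     [z]. *)
  pose z := v *m N; pose s := form 1%:M z z.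
  have s0 : 0 <= s by rewrite /s -sqn sqnorm_ge0.
  pose c := form N z z.
  have c0 : 0 <= c := N0 z.
  have fvz : form N v z = s by rewrite /s /form mulmx1.
  have s_eq0 : s = 0.
    apply: (@quadratic_ge0_linear_eq0 R s c s0 c0) => t.
    have := N0 (v + (- t) *: z).
    by rewrite formD1 !formD2 !formZ1 !formZ2 (formC _ z v)// Nv fvz -/c add0r.
  have : sqnorm z^T == 0 by rewrite sqn -/s s_eq0.
  by rewrite sqnorm_eq0 trmx_eq0 => /eqP.
have evM : eigenvalue M mu.
  apply/eigenvalueP; exists v.
    by apply/eqP; rewrite -subr_eq0 -mul_mx_scalar -mulmxBr vN.
  apply/negP => /eqP v0; move: Av; rewrite /A /= v0 trmx0 sqnormE mulmx0 mxE.
  by move=> /eqP; rewrite eq_sym oner_eq0.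
have lmu : lambda_min M <= mu.
  apply: ge_inf => //; exists 0 => a /= /(posdefmx_eigenvalue_gt0 Mpos).
  exact: ltW.
have := N0 u^T; rewrite NE subr_ge0 -sqn trmxK.
have -> : form M u^T u^T = (u^T *m M *m u) ord0 ord0 by rewrite /form trmxK.
by apply: le_trans; rewrite ler_wpM2r ?sqnorm_ge0.
Qed.

Lemma lambda_min_ge0 M : posdefmx M -> 0 <= lambda_min M.
Proof.
move=> Mpos; rewrite /lambda_min.
(* A spectrum that is empty gives the conventional infimum 0, which is enough here. *)
have [->|/set0P ex] := eqVneq [set a | eigenvalue M a] set0; first by rewrite inf0.
by apply: lb_le_inf => // a /(posdefmx_eigenvalue_gt0 Mpos) /ltW.
Qed.

Lemma sqnorm_sqrtmx M S u : posdefmx S -> S *m S = M ->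
  sqnorm (S *m u) = (u^T *m M *m u) ord0 ord0.
Proof. by move=> [ST _] <-; rewrite sqnormE trmx_mul ST !mulmxA. Qed.

Lemma posdefmx_unitmx M : posdefmx M -> M \in unitmx.
Proof. by move=> /posdefmx_det_gt0 M0; rewrite unitmxE unitfE gt_eqF. Qed.

Lemma det_sqrtmx M S : posdefmx S -> S *m S = M -> \det S = Num.sqrt (\det M).
Proof.
move=> /posdefmx_det_gt0 S0 <-; rewrite det_mulmx -expr2 sqrtr_sqr gtr0_norm//.
Qed.

End quadratic_forms.

(** * Borel sets of [R^d] from the coordinate sigma-algebra *)

Section cvector_measurability.
Context {R : realType} {n : nat}.

Lemma measurable_coord (i : 'I_n) :
  measurable_fun setT (fun u : 'cV[R]_n => u i ord0).
Proof.
move=> _ B mB; rewrite setTI; apply: sub_sigma_algebra.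
by exists i, B.
Qed.

Lemma measurable_fun_cvector d (T : measurableType d) (D : set T)
    (f : T -> 'cV[R]_n) :
  (forall i, measurable_fun D (fun x => f x i ord0)) -> measurable_fun D f.
Proof.
move=> mf mD; apply: (@measurability _ _ _ _ D f (@cvector_gen R n)) => //.
by move=> _ [_ [i [B [mB ->]]] <-]; exact: mf.
Qed.

(** An open set is the union of the boxes with rational centre and radius [1/(k+1)] that it
    contains. There are countably many of them, and each is a finite intersection of generators. *)
Lemma open_measurable_cvector (U : set 'cV[R]_n) : open U -> measurable U.
Proof.
move=> oU; pose box (qk : 'cV[rat]_n * nat) : set 'cV[R]_n :=
  \bigcap_(i in [set: 'I_n]) [set u | `|u i ord0 - ratr (qk.1 i ord0)| < qk.2.+1%:R^-1].
pose F qk := if `[< box qk `<=` U >] then box qk else set0.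
have -> : U = \bigcup_qk F qk.
  apply/seteqP; split=> [u Uu|u [qk _]]; last first.
    by rewrite /F; case: ifPn => // /asboolP; apply.
  have /nbhs_ballP[e /= e0 eU] : nbhs u U by exact: open_nbhs_nbhs.
  (* The factor 2 pays for the two distances to the centre [q] of the box: that of [u] and that of
     an arbitrary point [v]. *)
  have [k ke] : exists k : nat, 2 * k.+1%:R^-1 < e.
    have [k ke] := ltr_add_invr (y := 0) (x := e / 2) ltac:(by rewrite divr_gt0).
    by exists k; rewrite mulrC -ltr_pdivlMr//; rewrite add0r in ke.
  have : 0 < k.+1%:R^-1 :> R by rewrite invr_gt0.
  have [c cE] : exists c : R, c = k.+1%:R^-1 by eexists.
  rewrite -cE in ke *; move=> c0.
  have qE (i : 'I_n) : exists q : rat, `|u i ord0 - ratr q| < c.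
    have [|q] := @rat_in_itvoo R (u i ord0 - c) (u i ord0 + c); first by lra.
    rewrite in_itv/= => /andP[q1 q2]; exists q.
    by rewrite ltr_norml; apply/andP; split; lra.
  pose q : 'cV[rat]_n := \col_i projT1 (cid (qE i)).
  exists (q, k) => //; rewrite /F asboolT.
    by move=> i _ /=; rewrite mxE -cE; case: cid.
  move=> v qv; apply: eU; rewrite -ball_normE /ball_ /=.
  rewrite [ltLHS]/Num.norm /= mx_normrE; apply/bigmax_ltP; split => // -[i j] _ /=.
  rewrite ord1 !mxE; have := qv i I; rewrite /= mxE -cE; case: cid => r /= ur vr.
  rewrite (le_lt_trans _ ke)// [leRHS]mulr_natl mulr2n.
  rewrite (le_trans (ler_distD (ratr r) _ _))// lerD// ltW//.
  by rewrite distrC.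
apply: countable_bigcupT_measurable => // qk.
rewrite /F; case: ifPn => // _; apply: fin_bigcap_measurable => // i _.
have := measurable_coord i measurableT _ (measurable_ball (ratr (qk.1 i ord0)) qk.2.+1%:R^-1).
rewrite setTI; congr measurable; apply/funext => u; rewrite /= -ball_normE /=.
by rewrite distrC.
Qed.

Lemma compact_measurable_cvector (K : set 'cV[R]_n) : compact K -> measurable K.
Proof.
move=> /compact_closed cK; rewrite -[K]setCK; apply: measurableC.
apply: open_measurable_cvector; apply: closed_openC; apply: cK.
exact: norm_hausdorff.
Qed.

Lemma continuous_measurable_cvector (D : set 'cV[R]_n) (f : 'cV[R]_n -> R) :
  measurable D -> {within D, continuous f} -> measurable_fun D f.
Proof.
move=> mD /continuousP cf; apply: (measurability _ (RGenOpens.measurableE R)).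
move=> _ [_ [a [b ->] <-]].
have : open (f @^-1` `]a, b[ : set (subspace D)) by exact/cf/interval_open.
move=> /open_subspaceP[V oV VD].
rewrite setIC -VD; apply: measurableI => //; exact: open_measurable_cvector.
Qed.

End cvector_measurability.

Lemma measurable_affine {R : realType} {n m} (A : 'M[R]_(n, m)) (b : 'cV[R]_n) :
  measurable_fun setT (fun u : 'cV[R]_m => A *m u + b).
Proof.
apply: measurable_fun_cvector => i; under eq_fun do rewrite !mxE.
apply: measurable_funD => //; apply: measurable_sum => j.
by apply: measurable_funM => //; exact: measurable_coord.
Qed.

(** * Lebesgue measure and affine maps *)

(** The hypothesis says that [mu] is [c] times its own image under [phi]; integrating against both
    measures turns this scaling of sets into a substitution rule. *)
Lemma ge0_integral_scaled_pushforward {d} {T : measurableType d} {R : realType}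
    (mu : {measure set T -> \bar R}) (phi : T -> T) (c : R) (B : set T)
    (f : T -> \bar R) :
  measurable_fun setT phi -> 0 <= c ->
  (forall A, measurable A -> mu A = (c%:E * mu (phi @^-1` A))%E) ->
  measurable B -> measurable_fun B f -> (forall x, B x -> 0 <= f x)%E ->
  (\int[mu]_(x in B) f x = c%:E * \int[mu]_(x in phi @^-1` B) f (phi x))%E.
Proof.
move=> mphi c0 muE mB mf f0.
pose nu : {measure set T -> \bar R} :=
  @measure_function_pushforward__canonical__measure_function_Measure _ _ _ _ _ mu _ mphi.
rewrite (eq_measure_integral (mscale (NngNum c0) nu)) => [|A mA _]; last exact: muE.
rewrite ge0_integral_mscale//; congr (_ * _)%E.
by rewrite ge0_integral_pushforward// => x; rewrite inE; exact: f0.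
Qed.

Lemma lebesgue_measure_affine {R : realType} (a b : R) (A : set R) : a != 0 ->
  measurable A ->
  lebesgue_measure A = (`|a|%:E * lebesgue_measure ((fun t : R => (a * t + b)%R) @^-1` A))%E.
Proof.
move=> a0 mA; pose phi : measurableTypeR R -> measurableTypeR R := fun t => a * t + b.
have mphi : measurable_fun setT phi.
  by apply: measurable_funD => //; exact: mulrl_measurable.
pose nu : {measure set (measurableTypeR R) -> \bar R} :=
  @measure_function_pushforward__canonical__measure_function_Measure _ _ _ _ _
    (@lebesgue_measure R) _ mphi.
rewrite (@lebesgue_measure_unique _ (mscale (NngNum (normr_ge0 a)) nu))//.
move=> _ [[x y] _ <-] /=.
rewrite [RHS](_ : _ = (`|a|%:E * lebesgue_measure (phi @^-1` `]x, y]%classic))%E)//.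
have [a_lt0|a_gt0|] := ltgtP a 0; last by move/eqP; rewrite (negbTE a0).
(* A negative slope moves the closed end of the interval to the left; the length is unaffected. *)
- have -> : phi @^-1` `]x, y] = `[(y - b) / a, (x - b) / a[%classic.
    apply/seteqP; split=> t; rewrite /phi /= !in_itv/= ler_ndivrMr// ltr_ndivlMr//.
      by move=> /andP[? ?]; apply/andP; split; lra.
    by move=> /andP[? ?]; apply/andP; split; lra.
  rewrite !lebesgue_measure_itv/= !lte_fin ltr_nM2r ?invr_lt0// ltrD2r.
  case: ifPn => _; last by rewrite mule0.
  by rewrite -!EFinB -EFinM ltr0_norm//; congr _%:E; field.
- have -> : phi @^-1` `]x, y] = `](x - b) / a, (y - b) / a]%classic.
    apply/seteqP; split=> t; rewrite /phi /= !in_itv/= ler_pdivlMr// ltr_pdivrMr//.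
      by move=> /andP[? ?]; apply/andP; split; lra.
    by move=> /andP[? ?]; apply/andP; split; lra.
  rewrite !lebesgue_measure_itv/= !lte_fin ltr_pM2r ?invr_gt0// ltrD2r.
  case: ifPn => _; last by rewrite mule0.
  by rewrite -!EFinB -EFinM gtr0_norm//; congr _%:E; field.
Qed.

Section sigma_finite_pack.
Context {d} {T : measurableType d} {R : realType} {mu : {measure set T -> \bar R}}.
Variable mu_sf : sigma_finite setT mu.

(** The same measure under a new name, to which the proof [mu_sf] attaches the sigma-finite
    structure required by Fubini's theorem. [lebesgue_cv] is a fixpoint with values in plain
    measures. *)
Definition sigma_finite_pack of sigma_finite setT mu : set T -> \bar R := mu.

HB.instance Definition _ := Measure.copy (sigma_finite_pack mu_sf) mu.
HB.instance Definition _ :=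
  Measure_isSigmaFinite.Build _ _ _ (sigma_finite_pack mu_sf) mu_sf.

End sigma_finite_pack.

Section lebesgue_measure_cvector.
Context {R : realType}.
Local Notation leb := (lebesgue_cv R).

Lemma lebesgue_cvSE n (B : set 'cV[R]_n.+1) :
  leb n.+1 B = (leb n \x @lebesgue_measure R)%E (@cvector_cons R n @^-1` B).
Proof. by []. Qed.

Lemma lebesgue_cv_box n (r : R) : (0 <= r) ->
  measurable (\bigcap_(i in [set: 'I_n]) [set u : 'cV[R]_n | `|u i ord0| <= r]) /\
  (leb n (\bigcap_(i in [set: 'I_n]) [set u : 'cV[R]_n | (`|u i ord0| <= r)%R]) < +oo)%E.
Proof.
move=> r0; have mbox k :
    measurable (\bigcap_(i in [set: 'I_k]) [set u : 'cV[R]_k | `|u i ord0| <= r]).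
  apply: fin_bigcap_measurable => // i _.
  have := measurable_coord i measurableT _ (measurable_itv `[- r, r]).
  rewrite setTI; congr measurable; apply/funext => u /=.
  by rewrite in_itv/= ler_norml.
split=> //; elim: n => [|n IH].
  by rewrite /= diracE ltry.
rewrite lebesgue_cvSE.
set B := (X in leb n X) in IH.
have -> : @cvector_cons R n @^-1` (\bigcap_(i in [set: 'I_n.+1])
    [set u : 'cV[R]_n.+1 | `|u i ord0| <= r]) = B `*` `[- r, r]%classic.
  apply/seteqP; split=> [[u t] ut|[u t] [/= Bu ut] i _ /=].
    split=> [i _|] /=.
      by have := ut (lift ord0 i) I; rewrite /= mxE liftK.
    by have := ut ord0 I; rewrite /= mxE unlift_none in_itv/= ler_norml.
  rewrite mxE; case: unliftP => [j _|_]; first exact: Bu.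
  by move: ut; rewrite in_itv/= ler_norml.
rewrite product_measure1E//; last exact: mbox.
rewrite lte_mul_pinfty// ?ge0_fin_numE//.
rewrite [ltLHS](_ : _ = lebesgue_measure `[(- r)%R, r]%classic)//.
by rewrite lebesgue_measure_itv/=; case: ifP => // _; rewrite -EFinB ltry.
Qed.

Lemma lebesgue_cv_sigma_finite n : sigma_finite setT (leb n).
Proof.
exists (fun k : nat => \bigcap_(i in [set: 'I_n]) [set u : 'cV[R]_n | `|u i ord0| <= k%:R]).
  apply/seteqP; split=> // u _; exists (Num.truncn `|u|).+1 => // i _ /=.
  apply: ltW; apply: le_lt_trans (truncnS_gt _).
  rewrite [leRHS]/Num.norm /= mx_normrE.
  by apply/bigmax_geP; right; exists (i, ord0).
by move=> k; exact: lebesgue_cv_box.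
Qed.

Definition lebesgue_sf n : {sigma_finite_measure set 'cV[R]_n -> \bar R} :=
  sigma_finite_pack (lebesgue_cv_sigma_finite n).

Lemma cvector_consE n (u : 'cV[R]_n) (t : R) :
  cvector_cons (u, t) = col_mx (t%:M : 'M[R]_1) u.
Proof.
apply/colP => i; rewrite [LHS]mxE; case: (unliftP ord0 i) => [j|] ->.
  have -> : lift ord0 j = rshift 1 j by exact: val_inj.
  exact: (esym (col_mxEd (t%:M : 'M[R]_1) u j ord0)).
have -> : ord0 = lshift n ord0 :> 'I_(1 + n) by exact: val_inj.
by rewrite [RHS](col_mxEu (t%:M : 'M[R]_1) u ord0 ord0) mxE eqxx mulr1n.
Qed.

Lemma cvector_cons_xsection n (B : set 'cV[R]_n.+1) (u : 'cV[R]_n) :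
  xsection (@cvector_cons R n @^-1` B) u = [set t : R | B (cvector_cons (u, t))].
Proof. by apply/seteqP; split=> t; rewrite /xsection /= inE. Qed.

Lemma cvector_cons_ysection n (B : set 'cV[R]_n.+1) (t : R) :
  ysection (@cvector_cons R n @^-1` B) t = [set u : 'cV[R]_n | B (cvector_cons (u, t))].
Proof. by apply/seteqP; split=> u; rewrite /ysection /= inE. Qed.

Let measurable_cons_preimage n (B : set 'cV[R]_n.+1) : measurable B ->
  measurable (@cvector_cons R n @^-1` B).
Proof.
by move=> mB; rewrite -[X in measurable X]setTI; exact: measurable_cvector_cons.
Qed.

Lemma block_mulmx_cvector_cons n (a : R) (r : 'rV[R]_n) (c : 'cV[R]_n)
    (S : 'M[R]_n) (b : 'cV[R]_(1 + n)) (u : 'cV[R]_n) (t : R) :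
  block_mx (a%:M : 'M[R]_1) r c S *m (cvector_cons (u, t) : 'cV[R]_(1 + n)) + b =
  cvector_cons (t *: c + S *m u + dsubmx b,
                a * t + (r *m u) ord0 ord0 + usubmx b ord0 ord0).
Proof.
rewrite !cvector_consE mul_block_col -[in LHS](vsubmxK b) add_col_mx.
rewrite -scalar_mxM mul_mx_scalar; congr col_mx.
by apply/matrixP => i j; rewrite !ord1 !mxE/= ?mulr1n.
Qed.

Lemma lebesgue_cvS_xsection n (B : set 'cV[R]_n.+1) :
  leb n.+1 B =
  (\int[leb n]_u lebesgue_measure [set t : R | B (cvector_cons (u, t))])%E.
Proof.
by rewrite lebesgue_cvSE; apply: eq_integral => u _ /=; rewrite cvector_cons_xsection.
Qed.

(** The definition of the product makes [u] the outer variable. The opposite order follows from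
    uniqueness of the product measure, which is where sigma-finiteness of [leb n] enters. *)
Lemma lebesgue_cvS_ysection n (B : set 'cV[R]_n.+1) : measurable B ->
  leb n.+1 B =
  (\int[lebesgue_measure]_t leb n [set u : 'cV[R]_n | B (cvector_cons (u, t))])%E.
Proof.
move=> mB; rewrite lebesgue_cvSE.
rewrite (@product_measure_unique _ _ _ _ _ (lebesgue_sf n) lebesgue_measure
  (lebesgue_sf n \x^ lebesgue_measure)%E)//; last 2 first.
- by move=> *; exact: product_measure2E.
- exact: measurable_cons_preimage.
by apply: eq_integral => t _ /=; rewrite cvector_cons_ysection.
Qed.

Let measurable_fun_xsection_cons n (B : set 'cV[R]_n.+1) : measurable B ->
  measurable_fun setT
    (fun u : 'cV[R]_n => lebesgue_measure [set t : R | B (cvector_cons (u, t))]).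
Proof.
move=> /measurable_cons_preimage /(measurable_fun_xsection (@lebesgue_measure R)).
by congr measurable_fun; apply/funext => u /=; rewrite cvector_cons_xsection.
Qed.

Let measurable_fun_ysection_cons n (B : set 'cV[R]_n.+1) : measurable B ->
  measurable_fun setT
    (fun t : R => leb n [set u : 'cV[R]_n | B (cvector_cons (u, t))]).
Proof.
move=> /measurable_cons_preimage /(measurable_fun_ysection (lebesgue_sf n)).
by congr measurable_fun; apply/funext => t /=; rewrite cvector_cons_ysection.
Qed.

Let affine_preimage {n} (A : 'M[R]_n) (b : 'cV[R]_n) (B : set 'cV[R]_n) :=
  (fun u : 'cV[R]_n => A *m u + b) @^-1` B.

Let measurable_affine_preimage n (A : 'M[R]_n) b B : measurable B ->
  measurable (affine_preimage A b B).
Proof. by move=> mB; rewrite -[X in measurable X]setTI; exact: measurable_affine. Qed.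

(** The translation [b] is quantified inside the property: on a section, the fixed coordinate
    contributes a shift that varies with the section. *)
Let scales {n} (A : 'M[R]_n) := forall b B, measurable B ->
  leb n B = (`|\det A|%:E * leb n (affine_preimage A b B))%E.

Let scales_mul n (A A' : 'M[R]_n) : scales A -> scales A' -> scales (A *m A').
Proof.
move=> sA sA' b B mB; rewrite (sA b B mB) (sA' 0).
  rewrite muleA -EFinM -normrM -det_mulmx; congr (_ * leb n _)%E.
  by apply/seteqP; split=> u; rewrite /affine_preimage /= addr0 mulmxA.
exact: measurable_affine_preimage.
Qed.

(** The last [n] coordinates move by [u |-> S u + b1], independently of [t], so [u] is the outer
    variable; for fixed [u] the first coordinate undergoes a one-dimensional affine map of slope
    [a]. *)
Let scales_upper n (a : R) (r : 'rV[R]_n) (S : 'M[R]_n) : a != 0 -> scales S ->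
  scales (block_mx (a%:M : 'M[R]_1) r 0 S : 'M[R]_(1 + n)).
Proof.
move=> a0 sS b B mB.
rewrite det_ublock det_scalar expr1.
pose h (u : 'cV[R]_n) := lebesgue_measure [set t : R | B (cvector_cons (u, t))].
pose b0 : R := usubmx (b : 'cV_(1 + n)) ord0 ord0.
pose b1 : 'cV[R]_n := dsubmx (b : 'cV_(1 + n)).
have mh : measurable_fun setT h by exact: measurable_fun_xsection_cons.
rewrite lebesgue_cvS_xsection -/h.
rewrite (@ge0_integral_scaled_pushforward _ _ _ _ (fun u => S *m u + b1) `|\det S|)//;
  [|exact: measurable_affine|exact: sS].
rewrite normrM EFinM [(`|a|%:E * _)%E]muleC -muleA; congr (_ * _)%E.
rewrite preimage_setT lebesgue_cvS_xsection -ge0_integralZl_EFin//; last first.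
  by apply: measurable_fun_xsection_cons; exact: (@measurable_affine_preimage n.+1).
apply: eq_integral => u _.
rewrite /h (lebesgue_measure_affine a ((r *m u) ord0 ord0 + b0) _ a0); last first.
  by rewrite -cvector_cons_xsection; apply: measurable_xsection; exact: measurable_cons_preimage.
congr (_ * lebesgue_measure _)%E; apply/funext => t /=.
rewrite /affine_preimage/= (block_mulmx_cvector_cons n a r 0 S b u t).
by rewrite scaler0 add0r addrA.
Qed.

(** Now [t] moves on its own while [u] is translated by [t c + b1], so the sections are taken in the
    other order. *)
Let scales_lower n (c : 'cV[R]_n) : scales (1%:M : 'M[R]_n) ->
  scales (block_mx (1%:M : 'M[R]_1) 0 c 1%:M : 'M[R]_(1 + n)).
Proof.
move=> s1 b B mB.
rewrite det_lblock !det1 mulr1 normr1 mul1e.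
pose h (t : R) := leb n [set u : 'cV[R]_n | B (cvector_cons (u, t))].
pose b0 : R := usubmx (b : 'cV_(1 + n)) ord0 ord0.
pose b1 : 'cV[R]_n := dsubmx (b : 'cV_(1 + n)).
have mh : measurable_fun setT h by exact: measurable_fun_ysection_cons.
rewrite lebesgue_cvS_ysection// -/h.
rewrite (@ge0_integral_scaled_pushforward _ _ R (@lebesgue_measure R)
  (fun t : R => 1 * t + b0) `|1|)//; last 2 first.
- by apply: measurable_funD => //; exact: mulrl_measurable.
- by move=> A mA; exact: lebesgue_measure_affine.
rewrite normr1 mul1e preimage_setT lebesgue_cvS_ysection; last first.
  exact: measurable_affine_preimage.
apply: eq_integral => t _.
rewrite /h (s1 (t *: c + b1)); last first.
  by rewrite -cvector_cons_ysection; apply: measurable_ysection; exact: measurable_cons_preimage.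
rewrite det1 normr1 mul1e; congr (leb n _); apply/funext => u /=.
apply: (etrans _ (congr1 B (esym (block_mulmx_cvector_cons n 1 0 c 1%:M b u t)))).
by rewrite /affine_preimage/= !mul1mx mul0mx mxE addr0 [u + _]addrCA -[t *: c + u + _]addrA.
Qed.

(* By induction on the dimension, with the Schur complement of the upper left entry;
   if that entry vanishes, a shear first makes it nonzero. *)
Lemma lebesgue_cv_affine n (A : 'M[R]_n) (b : 'cV[R]_n) (B : set 'cV[R]_n) :
  A \in unitmx -> measurable B ->
  leb n B = (`|\det A|%:E * leb n ((fun u => (A *m u + b)%R) @^-1` B))%E.
Proof.
move=> Au; suff sA : scales A by exact: sA.
elim: n A {b B} Au => [|n IH] A Au.
  move=> b B mB; rewrite det_mx00 normr1 mul1e; congr (leb 0 _).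
  by apply/seteqP; split=> u; rewrite /affine_preimage /= [A *m u + b]flatmx0 [u]flatmx0.
have s1 : scales (1%:M : 'M[R]_n) by apply: IH; exact: unitmx1.
have schur (M : 'M[R]_(1 + n)) : M \in unitmx -> ulsubmx M ord0 ord0 != 0 -> scales M.
  move=> Mu; set a := ulsubmx M ord0 ord0 => a0.
  pose S := drsubmx M - a^-1 *: (dlsubmx M *m ursubmx M).
  have ulE : ulsubmx M = a%:M by exact: mx11_scalar.
  have ME : M = block_mx (1%:M : 'M[R]_1) 0 (a^-1 *: dlsubmx M) 1%:M *m
                block_mx (a%:M : 'M[R]_1) (ursubmx M) 0 S.
    rewrite mulmx_block !mul1mx !mul0mx ?mulmx0 !addr0 mul_mx_scalar scalerA.
    rewrite divff// scale1r -scalemxAl addrC subrK -ulE.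
    by rewrite submxK.
  move: Mu; rewrite ME => Mu; apply: scales_mul; first exact: scales_lower.
  apply: scales_upper => //; apply: IH.
  move: Mu; rewrite unitmx_mul => /andP[_]; rewrite unitmxE det_ublock unitrM.
  by case/andP.
have [a0|] := eqVneq (@ulsubmx R 1 n 1 n A ord0 ord0) 0; last exact: schur.
have [i iA] : exists i, @dlsubmx R 1 n 1 n A i ord0 != 0.
  apply: contrapT => /forallNP A0; move: Au; rewrite unitmxE.
  have dl0 : @dlsubmx R 1 n 1 n A = 0.
    by apply/colP => i; rewrite [RHS]mxE; have /negP := A0 i; rewrite negbK => /eqP.
  have ul0 : @ulsubmx R 1 n 1 n A = 0 by apply/matrixP => i j; rewrite !ord1 [RHS]mxE.
  rewrite -[A](@submxK R 1 n 1 n) dl0 ul0 (@det_ublock R 1 n).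
  by rewrite det_mx11 mxE mul0r unitr0.
(* Left multiplication by [E 1] adds to the first row the row whose first entry is nonzero, which
   makes the upper left entry nonzero; [E (-1)] undoes this and is upper block triangular. *)
pose E (s : R) : 'M[R]_(1 + n) := block_mx (1%:M : 'M[R]_1) (s *: delta_mx ord0 i) 0 1%:M.
have EE : E (-1) *m E 1 = 1%:M.
  rewrite /E mulmx_block !mul1mx !mulmx1 !mul0mx !mulmx0 !addr0 add0r.
  by rewrite scaleN1r scale1r subrr -scalar_mx_block.
have -> : A = E (-1) *m (E 1 *m (A : 'M[R]_(1 + n))) by rewrite mulmxA EE mul1mx.
apply: scales_mul.
  by apply: scales_upper => //; exact: oner_neq0.
apply: schur; first by rewrite unitmx_mul Au andbT; case/mulmx1_unit: EE.
rewrite -[A](@submxK R 1 n 1 n) /E mulmx_block block_mxKul mul1mx mxE a0 add0r.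
by rewrite scale1r -rowE mxE.
Qed.

End lebesgue_measure_cvector.

(** * Integrals with values in the extended reals *)

Section extended_integrals.
Local Open Scope ereal_scope.
Context {d} {T : measurableType d} {R : realType} (mu : {measure set T -> \bar R}).
Implicit Types (D : set T) (f g : T -> \bar R).

(* The divergence is not known to depend measurably on the parameter; the integral
   of any nonnegative function is a supremum over the simple functions below it. *)
Lemma le_integral_nonmeasurable D f g : (forall x, D x -> f x <= g x) ->
  \int[mu]_(x in D) f x <= \int[mu]_(x in D) g x.
Proof.
move=> fg; have fgD x : (f \_ D) x <= (g \_ D) x.
  by rewrite /patch; case: ifPn => // /set_mem; exact: fg.
apply: leeB; apply: le_ereal_sup => _ [h hle <-]; exists h => // x;
  apply: le_trans (hle x) _.
- by rewrite !funeposE ge_max !le_max lexx orbT fgD.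
- by rewrite !funenegE ge_max !le_max lexx orbT leeN2 fgD.
Qed.

Lemma fin_num_integral_integrable D f : measurable D -> measurable_fun D f ->
  \int[mu]_(x in D) f x \is a fin_num -> mu.-integrable D f.
Proof.
move=> mD mf; rewrite integralE fin_numB => /andP[fp fn].
apply/integrableP; split=> //.
rewrite (_ : (fun x => `|f x|) = abse \o f)// fune_abse.
rewrite ge0_integralD//; [|exact: measurable_funepos|exact: measurable_funeneg].
by rewrite lte_add_pinfty// -ge0_fin_numE//; exact: integral_ge0.
Qed.

(** Adding an integrable function never changes which of the integrals of the positive and the
    negative part are infinite, since each part changes by at most [|h|]. The two sides are then
    compared in the four resulting cases. *)
Lemma integral_addr_integrable D f (h : T -> R) : measurable D ->
  measurable_fun D f -> mu.-integrable D (EFin \o h) ->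
  \int[mu]_(x in D) (f x + (h x)%:E) =
  \int[mu]_(x in D) f x + \int[mu]_(x in D) (h x)%:E.
Proof.
move=> mD mf ih.
have mh : measurable_fun D (EFin \o h) := measurable_int _ ih.
have [_ habs] := integrableP _ _ _ ih.
have mfh : measurable_fun D (fun x => f x + (h x)%:E) by exact: emeasurable_funD.
have le_abs (F G : T -> \bar R) : measurable_fun D F -> measurable_fun D G ->
    (forall x, 0 <= F x) -> (forall x, 0 <= G x) ->
    (forall x, F x <= G x + `|(h x)%:E|) ->
    \int[mu]_(x in D) G x < +oo -> \int[mu]_(x in D) F x < +oo.
  move=> mF mG F0 G0 FG Gfin.
  have mabs : measurable_fun D (fun x => `|(h x)%:E|) by exact: measurableT_comp.
  apply: (@le_lt_trans _ _ (\int[mu]_(x in D) (G x + `|(h x)%:E|))).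
    by apply: ge0_le_integral => //; exact: emeasurable_funD.
  by rewrite ge0_integralD// lte_add_pinfty.
have posD (x y : \bar R) : maxe (x + y) 0 <= maxe x 0 + `|y|.
  rewrite ge_max adde_ge0 ?le_max ?lexx ?orbT// andbT.
  by rewrite leeD ?le_max ?lexx// lee_abs.
pose F := fun x => f x + (h x)%:E.
have mfp : measurable_fun D f^\+ by exact: measurable_funepos.
have mfn : measurable_fun D f^\- by exact: measurable_funeneg.
have mFp : measurable_fun D F^\+ by exact: measurable_funepos.
have mFn : measurable_fun D F^\- by exact: measurable_funeneg.
have fE x : f x = F x + (- h x)%:E.
  by rewrite /F -addeA -EFinD subrr adde0.
have le1 : \int[mu]_(x in D) f^\+ x < +oo -> \int[mu]_(x in D) F^\+ x < +oo.
  by apply: le_abs => // x; rewrite !funeposE; exact: posD.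
have le2 : \int[mu]_(x in D) f^\- x < +oo -> \int[mu]_(x in D) F^\- x < +oo.
  apply: le_abs => // x; rewrite !funenegE /F oppeD ?fin_num_adde_defl//.
  by rewrite -[X in _ + `|X|]oppeK abseN; exact: posD.
have le3 : \int[mu]_(x in D) F^\+ x < +oo -> \int[mu]_(x in D) f^\+ x < +oo.
  apply: le_abs => // x; rewrite !funeposE fE.
  by rewrite (le_trans (posD _ _))// EFinN abseN.
have le4 : \int[mu]_(x in D) F^\- x < +oo -> \int[mu]_(x in D) f^\- x < +oo.
  apply: le_abs => // x; rewrite !funenegE fE oppeD ?fin_num_adde_defl//.
  by rewrite -EFinN opprK; exact: posD.
have hfin : \int[mu]_(x in D) (h x)%:E \is a fin_num by exact: integrable_fin_num.
(* Once the negative part has infinite integral, both sides are [-oo] whatever the positive part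
   does, because [+oo - oo = -oo]; the second and the fourth case are therefore alike. *)
have [fp|fp] := ltP (\int[mu]_(x in D) f^\+ x) +oo;
have [fn|fn] := ltP (\int[mu]_(x in D) f^\- x) +oo.
- apply: integralD => //; apply: fin_num_integral_integrable => //.
  by rewrite integralE fin_numB !ge0_fin_numE ?fp ?fn//; exact: integral_ge0.
- have Fn : \int[mu]_(x in D) F^\- x = +oo.
    by apply/eqP; rewrite eq_le leey leNgt; apply/negP => /le4; rewrite ltNge fn.
  move: fn; rewrite leye_eq => /eqP fn.
  rewrite integralE [in RHS]integralE fn -/F Fn /= !addeNy.
  by move: hfin; case: (\int[mu]_(x in D) (h x)%:E).
- have Fp : \int[mu]_(x in D) F^\+ x = +oo.
    by apply/eqP; rewrite eq_le leey leNgt; apply/negP => /le3; rewrite ltNge fp.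
  move: fp; rewrite leye_eq => /eqP fp.
  have fnfin : \int[mu]_(x in D) f^\- x \is a fin_num.
    by rewrite ge0_fin_numE// integral_ge0.
  have Fnfin : \int[mu]_(x in D) F^\- x \is a fin_num.
    by rewrite ge0_fin_numE ?le2// integral_ge0.
  rewrite integralE [in RHS]integralE fp -/F Fp /=.
  by move: hfin fnfin Fnfin; case: (\int[mu]_(x in D) (h x)%:E);
     case: (\int[mu]_(x in D) f^\- x); case: (\int[mu]_(x in D) F^\- x).
- have Fn : \int[mu]_(x in D) F^\- x = +oo.
    by apply/eqP; rewrite eq_le leey leNgt; apply/negP => /le4; rewrite ltNge fn.
  move: fn; rewrite leye_eq => /eqP fn.
  rewrite integralE [in RHS]integralE fn -/F Fn /= !addeNy.
  by move: hfin; case: (\int[mu]_(x in D) (h x)%:E).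
Qed.

(* The convention [+oo - oo = -oo] makes the integral additive even when neither
   the positive nor the negative part is integrable. *)
Lemma integral_measurable_partition k (A : 'I_k -> set T) f :
  measurable_partition A -> measurable_fun setT f ->
  \int[mu]_x f x = \sum_j \int[mu]_(x in A j) f x.
Proof.
move=> [mA tA UA] mf.
(* Nonnegativity is carried through the induction because the regrouping fails if some [N j] may be
   [-oo]. *)
have sumB (P N : 'I_k -> \bar R) : (forall j, 0 <= P j) -> (forall j, 0 <= N j) ->
    \sum_j P j - \sum_j N j = \sum_j (P j - N j).
  move=> P0 N0.
  suff [_ _ //] : [/\ 0 <= \sum_j P j, 0 <= \sum_j N j &
    \sum_j P j - \sum_j N j = \sum_j (P j - N j)].
  apply: (big_ind3 (fun p n s : \bar R => [/\ 0 <= p, 0 <= n & p - n = s])) => //.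
  - by split => //; rewrite sube0.
  - move=> p1 n1 s1 p2 n2 s2 [p1_ge0 n1_ge0 <-] [p2_ge0 n2_ge0 <-].
    split; [exact: adde_ge0|exact: adde_ge0|].
    case: p1 p1_ge0 => [p1||]//; case: p2 p2_ge0 => [p2||]//;
    case: n1 n1_ge0 => [n1||]//; case: n2 n2_ge0 => [n2||]// _ _ _ _.
    by congr _%:E; rewrite opprD addrACA.
have ge0_part g : measurable_fun setT g -> (forall x, 0 <= g x) ->
    \int[mu]_x g x = \sum_j \int[mu]_(x in A j) g x.
  move=> mg g0; have UA' : \big[setU/set0]_(j <- index_enum 'I_k) A j = setT.
    rewrite -bigcup_seq -UA; apply: eq_bigcupl; split=> // i _ /=.
    exact: mem_index_enum.
  rewrite -UA' ge0_integral_bigsetU//.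
  - exact: index_enum_uniq.
  - exact: sub_trivIset tA.
  - by rewrite UA'.
rewrite integralE !ge0_part//; [|exact: measurable_funeneg|exact: measurable_funepos].
rewrite sumB => [|j|j]; [|exact: integral_ge0..].
by apply: eq_bigr => j _; rewrite [RHS]integralE.
Qed.

(* On [D] the functions [f] and [g] are almost everywhere finite where [r > 0],
   although neither [r * f] nor [r * g] need be integrable. *)
Lemma integral_mule_sub (D : set T) (r f g : T -> \bar R) (q c : R) :
  measurable D -> measurable_fun D r -> measurable_fun D f -> measurable_fun D g ->
  (forall x, 0 <= r x) -> (forall x, f x != -oo) -> (forall x, g x != -oo) ->
  (0 < q)%R -> \int[mu]_(x in D) r x = q%:E ->
  (\int[mu]_(x in D) r x)^-1 * \int[mu]_(x in D) (r x * (f x - g x)) = c%:E ->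
  \int[mu]_(x in D) (r x * f x) = \int[mu]_(x in D) (r x * g x) + (q * c)%:E.
Proof.
move=> mD mr mf mg r0 fNy gNy q0 rq; rewrite rq inver gt_eqF// => fgc.
pose h x := r x * (f x - g x).
have mh : measurable_fun D h by apply: emeasurable_funM => //; exact: emeasurable_funB.
have hE : \int[mu]_(x in D) h x = (q * c)%:E.
  by rewrite EFinM -fgc muleA -EFinM divff ?gt_eqF// mul1e.
have ih : mu.-integrable D h by apply: fin_num_integral_integrable => //; rewrite hE.
have ir : mu.-integrable D r by apply: fin_num_integral_integrable => //; rewrite rq.
have hae := integrable_ae mD ih.
have rae := integrable_ae mD ir.
have hfE : ae_eq mu D h (EFin \o fine \o h).
  by apply: filterS hae => x hx Dx /=; rewrite fineK// hx.
have mfh : measurable_fun D (EFin \o (fine \o h)).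
  by apply/measurable_EFinP; apply: measurableT_comp.
have hE' : \int[mu]_(x in D) (fine (h x))%:E = (q * c)%:E.
  by rewrite -hE; apply/esym/ae_eq_integral.
have ih' : mu.-integrable D (EFin \o (fine \o h)).
  by apply: fin_num_integral_integrable => //; rewrite hE'.
rewrite -hE' -integral_addr_integrable//; last exact: emeasurable_funM.
apply: ae_eq_integral => //.
- exact: emeasurable_funM.
- by apply: emeasurable_funD => //; exact: emeasurable_funM.
near=> x => Dx.
have : h x \is a fin_num by apply: (near hae x).
have : r x \is a fin_num by apply: (near rae x).
rewrite /= /h; have := r0 x; have := fNy x; have := gNy x.
case: (r x) => [a| |]// + + + _; rewrite lee_fin le_eqVlt => + + /orP[/eqP<-|a0].
  by rewrite !mul0e adde0.
(* With [-oo] excluded, an infinite [f x] or [g x] makes [f x - g x] infinite, even when both are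
   [+oo], against the finiteness of [h x]. *)
case: (f x) => [b| |]//; case: (g x) => [e| |]// _ _.
- by move=> _; rewrite /= -!EFinM -EFinD; congr _%:E; ring.
- by rewrite gt0_muleNy.
- by rewrite gt0_muley.
- by rewrite gt0_muleNy.
Unshelve. all: by end_near. Qed.

End extended_integrals.

(** * The mixture density and the codelength integrands *)

Section mixture_measurability.
Context {dT} {T : measurableType dT} {R : realType} {d : nat}.
Variables (nu : {sigma_finite_measure set T -> \bar R})
  (P : 'cV[R]_d -> probability T R) (p : 'cV[R]_d -> T -> R)
  (Theta K : set 'cV[R]_d) (pi : 'cV[R]_d -> R).
Hypotheses (p_density : forall theta, Theta theta ->
    has_density nu (P theta) (p theta))
  (p_measurable : measurable_fun (Theta `*` setT)
    (fun y : 'cV[R]_d * T => p y.1 y.2))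
  (Theta_open : open Theta) (K_compact : compact K) (K_sub : K `<=` Theta)
  (pi_cont : {within K, continuous pi}) (pi_gt0 : forall theta, K theta -> 0 < pi theta)
  (pi_density : (\int[lebesgue_cv R d]_(theta in K) (pi theta)%:E = 1)%E).
Local Open Scope ereal_scope.

Let mK : measurable K := compact_measurable_cvector K K_compact.

Let mTheta : measurable Theta := open_measurable_cvector Theta Theta_open.

Let mpi : measurable_fun K pi := continuous_measurable_cvector K pi mK pi_cont.

(** Extension by zero outside [K] makes the mixture a partial integral over a full product space,
    ready for Tonelli's theorem. *)
Let joint : 'cV[R]_d * T -> \bar R :=
  (fun y => (p y.1 y.2 * pi y.1)%:E) \_ (K `*` setT).

Let joint_ge0 y : 0 <= joint y.
Proof.
rewrite /joint /patch; case: ifPn => // /set_mem[/= Ky _].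
have [_ p0 _] := p_density _ (K_sub _ Ky).
by rewrite lee_fin mulr_ge0// ltW// pi_gt0.
Qed.

Let measurable_joint : measurable_fun setT joint.
Proof.
have mKT : measurable (K `*` [set: T]) by apply: measurableX.
have mThetaT : measurable (Theta `*` [set: T]) by apply: measurableX.
apply/(measurable_restrictT _ mKT).
apply/measurable_EFinP; apply: measurable_funM.
  by apply: (measurable_funS mThetaT _ p_measurable) => y [/= /K_sub].
apply: (measurable_comp mK _ mpi) => [_ [y [/= Ky _] <-]//|].
exact: measurable_funTS.
Qed.

Let mixtureE x : mixture p K pi x = \int[lebesgue_cv R d]_theta joint (theta, x).
Proof.
rewrite /mixture integral_mkcond; apply: eq_integral => theta _.
rewrite /joint /patch; congr (if _ then _ else _).
by apply/idP/idP => /set_mem => [Kt|[Kt _]]; apply: mem_set.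
Qed.

Lemma mixture_ge0 x : 0 <= mixture p K pi x.
Proof. by rewrite mixtureE; exact: integral_ge0. Qed.

Lemma measurable_mixture : measurable_fun setT (mixture p K pi).
Proof.
rewrite (_ : mixture p K pi = fubini_G (lebesgue_sf d) joint); last first.
  by apply/funext => x; rewrite mixtureE.
exact: measurable_fun_fubini_tonelli_G.
Qed.

(** Exchanging the integrals leaves the total mass 1 of each model distribution, then that of the
    prior. Summed over a partition, this says that the weights add up to 1. *)
Lemma integral_mixture : \int[nu]_x mixture p K pi x = 1.
Proof.
transitivity (\int[nu]_x \int[lebesgue_sf d]_theta joint (theta, x)).
  by apply: eq_integral => x _; rewrite mixtureE.
rewrite -(fubini_tonelli (m1 := lebesgue_sf d) (m2 := nu))//.
rewrite -pi_density [RHS]integral_mkcond; apply: eq_integral => theta _.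
rewrite /patch; case: ifPn => [/set_mem Kt|Kt].
  have [mp p0 PE] := p_density _ (K_sub _ Kt).
  transitivity (\int[nu]_x ((p theta x)%:E * (pi theta)%:E)).
    apply: eq_integral => x _; rewrite /joint /patch mem_set//.
  rewrite ge0_integralZr//; last 3 first.
  - exact/measurable_EFinP.
  - by move=> x _; rewrite lee_fin.
  - by rewrite lee_fin ltW// pi_gt0.
  by rewrite -PE// probability_setT mul1e.
rewrite integral0_eq// => x _; rewrite /joint /patch memNset// => -[/= Ktheta _].
by move: Kt; rewrite mem_set.
Qed.

Lemma neglog_neqNy (f : T -> R) x : neglog f x != -oo.
Proof. by rewrite /neglog /=; case: ifPn. Qed.

Lemma measurable_neglog (f : T -> R) : measurable_fun setT f ->
  measurable_fun setT (neglog f).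
Proof.
move=> mf; apply: measurableT_comp => //=.
apply: measurable_fun_ifT; first exact: measurable_fun_ler.
  exact: measurable_cst.
by apply/measurable_EFinP; apply: measurableT_comp => //; exact: measurable_ln.
Qed.

Lemma measurable_neglog_estimate (t : T -> 'cV[R]_d) : measurable_fun setT t ->
  (forall x, K (t x)) -> measurable_fun setT (fun x => neglog (p (t x)) x).
Proof.
move=> mt Kt.
have mp : measurable_fun setT (fun x => p (t x) x).
  apply: (@measurable_comp _ _ _ _ _ _ (Theta `*` setT)
    (fun y : 'cV[R]_d * T => p y.1 y.2) setT (fun x => (t x, x))) => //.
  - exact: measurableX.
  - by move=> _ [x _ <-]; split => //=; exact/K_sub/Kt.
  - exact: measurable_fun_pair.
exact: (measurable_neglog _ mp).
Qed.

End mixture_measurability.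

(** * Continuous functions on a compact set *)

Section compact_functions.
Context {R : realType} {d : nat}.
Implicit Types (K : set 'cV[R]_d) (f g : 'cV[R]_d -> R).

(** Compactness is used in its near-covering form, with radii tending to [0] from the right: a
    radius that works near each point works on all of [K]. *)
Lemma compact_uniformly_continuous K f : compact K -> {within K, continuous f} ->
  forall e : R, 0 < e -> exists2 r : R, 0 < r &
    forall x y, K x -> K y -> `|x - y| < r -> `|f x - f y| < e.
Proof.
move=> /compact_near_coveringP cK cf e e0.
have := cK R (0^'+) (fun r x => forall y, K x -> K y -> `|x - y| < r -> `|f x - f y| < e).
case=> [x Kx|r /= r0 rP].
  have : \forall z \near within K (nbhs x), `|f x - f z| < e / 2.
    by have /subspace_continuousP/(_ _ Kx)/cvgrPdist_lt := cf; apply; rewrite divr_gt0.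
  move=> /nbhs_ballP[r /= r0 rP]; have r2 : 0 < r / 2 by rewrite divr_gt0.
  near=> x' t => /= y Kx' Ky xy.
  have xx' : `|x - x'| < r / 2.
    by near: x'; apply/nbhs_ballP; exists (r / 2) => //= z; rewrite -ball_normE.
  have tr : t < r / 2 by near: t; exact: nbhs_right_lt.
  have fx' : `|f x - f x'| < e / 2.
    by apply: rP => //; rewrite -ball_normE /=; lra.
  have fy : `|f x - f y| < e / 2.
    apply: rP => //; rewrite -ball_normE /=.
    by rewrite (le_lt_trans (ler_distD x' _ _))//; lra.
  by rewrite (le_lt_trans (ler_distD (f x) _ _))// distrC; lra.
exists (r / 2); first by rewrite divr_gt0.
move=> x y Kx Ky; apply: (rP (r / 2)) => //=.
  by rewrite sub0r normrN gtr0_norm ?divr_gt0//; lra.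
by rewrite divr_gt0.
Unshelve. all: by end_near. Qed.

Lemma compact_positive_bounds K f : compact K -> K !=set0 ->
  {within K, continuous f} -> (forall x, K x -> 0 < f x) ->
  exists2 m : R, 0 < m & forall x, K x -> m <= f x.
Proof.
move=> cK K0 cf f0; have [c cinK cmin] := compact_EVT_min K0 cK cf.
by exists (f c) => [|x Kx]; [exact/f0/set_mem|exact/cmin/mem_set].
Qed.

Lemma compact_bounded_fun K f : compact K -> {within K, continuous f} ->
  exists2 M : R, 0 < M & forall x, K x -> `|f x| <= M.
Proof.
move=> cK cf; have /compact_bounded := continuous_compact cf cK.
by move=> /ex_strict_bound_gt0[M M0 fM]; exists M => // x Kx; apply: ltW; apply: fM; exists x.
Qed.

Lemma compact_lebesgue_lty K : compact K -> (lebesgue_cv R d K < +oo)%E.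
Proof.
move=> cK; have /ex_strict_bound_gt0[M M0 KM] := compact_bounded cK.
have [mB] := lebesgue_cv_box d M (ltW M0); apply: le_lt_trans.
apply: le_measure; rewrite ?inE//; first exact: compact_measurable_cvector.
move=> u /KM /ltW uM i _ /=; apply: le_trans uM.
rewrite [leRHS]/Num.norm /= mx_normrE.
by apply/bigmax_geP; right; exists (i, ord0).
Qed.

(** On [K] the function [f] stays between two positive constants, so its logarithm is bounded. This
    covers both the entropy of the prior and the log-determinant term. *)
Lemma compact_integrable_mul_ln K f g : compact K ->
  {within K, continuous f} -> {within K, continuous g} ->
  (forall x, K x -> 0 < f x) ->
  (lebesgue_cv R d).-integrable K (EFin \o (fun x => g x * ln (f x))).
Proof.
move=> cK cf cg f0.
have mK := compact_measurable_cvector _ cK.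
have mf := continuous_measurable_cvector _ _ mK cf.
have mg := continuous_measurable_cvector _ _ mK cg.
apply: measurable_bounded_integrable => //; first exact: compact_lebesgue_lty.
  apply: measurable_funM => //; apply: measurableT_comp => //; exact: measurable_ln.
have [K0|/set0P K0] := eqVneq K set0.
  by exists 0; split => // M _ x; rewrite K0.
have [m m0 fm] := compact_positive_bounds _ _ cK K0 cf f0.
have [M M0 fM] := compact_bounded_fun _ _ cK cf.
have [G G0 gG] := compact_bounded_fun _ _ cK cg.
exists (G * (`|ln m| + `|ln M|)); split => [|a aG x Kx]; first exact: num_real.
apply: le_trans (ltW aG); rewrite normrM ler_pM//; first exact: gG.
have lnm : ln m <= ln (f x) by rewrite ler_ln ?posrE ?f0//; exact: fm.
have lnM : ln (f x) <= ln M.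
  by rewrite ler_ln ?posrE ?f0//; apply: le_trans (ler_norm _) (fM _ Kx).
rewrite ler_norml; apply/andP; split.
  rewrite (le_trans _ lnm)// lerNl (le_trans (ler_norm (- ln m)))// normrN.
  by rewrite lerDl.
by rewrite (le_trans lnM)// (le_trans (ler_norm _))// lerDr.
Qed.

Lemma det_continuous : continuous (fun M : 'M[R]_d => \det M).
Proof.
move=> M; rewrite /determinant.
apply: (@cvg_big R^o _ +%R 0 xpredT _ _ (nbhs M)) => [|s _]; first exact: add_continuous.
apply: cvgMr.
apply: (@cvg_big R^o _ *%R 1 xpredT _ _ (nbhs M)) => [|i _]; first exact: mul_continuous.
exact: coord_continuous.
Qed.

Lemma within_det_continuous K (J : 'cV[R]_d -> 'M[R]_d) :
  {within K, continuous J} -> {within K, continuous (fun x => \det (J x))}.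
Proof.
move=> cJ x; apply: (@continuous_comp (subspace K) _ _ J (fun M => \det M)).
  exact: cJ.
exact: det_continuous.
Qed.

End compact_functions.

(** * The estimate on a single cell *)

(** Here [f] plays the prior, [s] the quadratic limit and [h] the divergence. Numerator and
    denominator of the [f]-mean of [s] are each within a factor [k] of their values for constant
    weight [c], so the mean is within a factor [k^2] of the plain one. As [1 - k^-2 <= k^2 - 1] and
    the mean is at most [B], this costs [B (k^2 - 1)]; replacing [s] by [h] costs [delta]. *)
Lemma weighted_mean_estimate {dT} {T : measurableType dT} {R : realType}
    (mu : {measure set T -> \bar R}) (W : set T) (f s : T -> R) (h : T -> \bar R)
    (c k B delta m : R) :
  measurable W -> mu W = m%:E -> 0 < m ->
  measurable_fun W f -> measurable_fun W s -> 0 < c -> 1 <= k -> 0 <= delta ->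
  (forall x, W x -> c / k <= f x <= c * k) -> (forall x, W x -> 0 <= s x <= B) ->
  (forall x, W x -> `|h x - (s x)%:E| <= delta%:E)%E ->
  [/\ c / k * m <= \int[mu]_(x in W) f x, \int[mu]_(x in W) f x <= c * k * m &
    exists2 y : R,
      ((\int[mu]_(x in W) (f x)%:E)^-1 * \int[mu]_(x in W) (h x * (f x)%:E) = y%:E)%E &
      `|y - (\int[mu]_(x in W) s x) / m| <= delta + B * (k ^+ 2 - 1)].
Proof.
move=> mW muW m0 mf ms c0 k1 delta0 fW sW hW.
have k0 : 0 < k by apply: lt_le_trans k1.
have muWlty : (mu W < +oo)%E by rewrite muW ltry.
have f0 x : W x -> 0 < f x.
  by move=> /fW/andP[+ _]; apply: lt_le_trans; rewrite divr_gt0.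
have bdd (g : T -> R) (b : R) : (forall x, W x -> `|g x| <= b) -> [bounded g x | x in W].
  move=> gb; exists b; split => [|a ba x Wx]; first exact: num_real.
  exact: le_trans (gb _ Wx) (ltW ba).
have intf : mu.-integrable W (EFin \o f).
  apply: measurable_bounded_integrable => //; apply: (bdd _ (c * k)) => x Wx.
  by rewrite gtr0_norm ?f0//; have /andP[] := fW _ Wx.
have ints : mu.-integrable W (EFin \o s).
  apply: measurable_bounded_integrable => //; apply: (bdd _ B) => x Wx.
  by have /andP[s0 sB] := sW _ Wx; rewrite ger0_norm.
have intsf : mu.-integrable W (EFin \o (fun x => s x * f x)).
  apply: measurable_bounded_integrable => //; first exact: measurable_funM.
  apply: (bdd _ (B * (c * k))) => x Wx.
  have /andP[s0 sB] := sW _ Wx; have /andP[_ fk] := fW _ Wx.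
  by rewrite normrM ger0_norm// gtr0_norm ?f0// ler_pM// ltW// f0.
have intc (r : R) : mu.-integrable W (EFin \o cst r).
  apply: measurable_bounded_integrable => //; exact: (bdd _ `|r|).
set F := \int[mu]_(x in W) f x; set Y := \int[mu]_(x in W) s x.
pose X := \int[mu]_(x in W) (s x * f x).
have Fge : c / k * m <= F.
  have <- : \int[mu]_(x in W) (c / k) = c / k * m by rewrite Rintegral_cst// muW.
  by apply: le_Rintegral => //; [exact: intc|move=> x /fW/andP[]].
have Fle : F <= c * k * m.
  have <- : \int[mu]_(x in W) (c * k) = c * k * m by rewrite Rintegral_cst// muW.
  by apply: le_Rintegral => //; [exact: intc|move=> x /fW/andP[]].
have F0 : 0 < F by apply: lt_le_trans Fge; rewrite !mulr_gt0// invr_gt0.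
have Y0 : 0 <= Y by apply: Rintegral_ge0 => x /sW/andP[].
have YB : Y <= B * m.
  have <- : \int[mu]_(x in W) B = B * m by rewrite Rintegral_cst// muW.
  by apply: le_Rintegral => //; [exact: intc|move=> x /sW/andP[]].
have Xge : c / k * Y <= X.
  rewrite -RintegralZl//; apply: le_Rintegral => // [|x Wx].
    exact: (integrableZl mW _ ints).
  have /andP[s0 _] := sW _ Wx; have /andP[fk _] := fW _ Wx.
  by rewrite mulrC ler_wpM2l.
have Xle : X <= c * k * Y.
  rewrite -RintegralZl//; apply: le_Rintegral => // [|x Wx].
    exact: (integrableZl mW _ ints).
  have /andP[s0 _] := sW _ Wx; have /andP[_ fk] := fW _ Wx.
  by rewrite mulrC ler_wpM2r.
have FE : (\int[mu]_(x in W) (f x)%:E = F%:E)%E.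
  by rewrite /F /Rintegral fineK//; exact: integrable_fin_num.
split => //.
(* With [a] equal to [delta] and [- delta], these are the measurable bounds between which the
   integral of [h * f] is squeezed. *)
have intX (a : R) : (\int[mu]_(x in W) ((s x + a) * f x)%:E = (X + a * F)%:E)%E.
  have -> : X + a * F = \int[mu]_(x in W) ((s x + a) * f x).
    rewrite -RintegralZl// -RintegralD//; last exact: (integrableZl mW _ intf).
    by apply: eq_Rintegral => x _; rewrite mulrDl.
  rewrite /Rintegral fineK//; apply: integrable_fin_num => //.
  have -> : (fun x => ((s x + a) * f x)%:E) =
      (EFin \o (fun x => s x * f x)) \+ (fun x => a%:E * (EFin \o f) x)%E.
    by apply/funext => x /=; rewrite mulrDl.
  by apply: integrableD => //; exact: integrableZl.
have hle x : W x -> (((s x - delta) * f x)%:E <= h x * (f x)%:E <= ((s x + delta) * f x)%:E)%E.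
  move=> Wx; have := hW _ Wx; have := f0 _ Wx; case: (h x) => [a| |]//= fx.
  rewrite !lee_fin ler_norml => /andP[? ?].
  by apply/andP; split; rewrite ler_pM2r//; lra.
have le1 : ((X - delta * F)%:E <= \int[mu]_(x in W) (h x * (f x)%:E))%E.
  have -> : X - delta * F = X + (- delta) * F by rewrite mulNr.
  by rewrite -intX; apply: le_integral_nonmeasurable => x /hle/andP[].
have le2 : (\int[mu]_(x in W) (h x * (f x)%:E) <= (X + delta * F)%:E)%E.
  by rewrite -intX; apply: le_integral_nonmeasurable => x /hle/andP[].
have /fineK : (\int[mu]_(x in W) (h x * (f x)%:E) \is a fin_num)%E.
  by rewrite fin_numE -ltNye -ltey (lt_le_trans _ le1) ?ltNyr// (le_lt_trans le2) ?ltry.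
move: le1 le2; set z := fine _ => + + zE; rewrite -zE !lee_fin => le1 le2.
exists (z / F); first by rewrite FE inver gt_eqF// -EFinM mulrC.
have XF : `|X / F - Y / m| <= B * (k ^+ 2 - 1).
  have [i iE] : exists i, i = k^-1 by exists k^-1.
  have i0 : 0 < i by rewrite iE invr_gt0.
  have ki : k * i = 1 by rewrite iE divff// gt_eqF.
  have Ek : c / k = c * i by rewrite iE.
  have [y ydef] : exists y, y = Y / m by exists (Y / m).
  have yE : Y = y * m by rewrite ydef divfK ?gt_eqF.
  have y0 : 0 <= y by rewrite ydef divr_ge0// ltW.
  have yB : y <= B by rewrite ydef ler_pdivrMr.
  rewrite -ydef; rewrite Ek yE in Xge; rewrite yE in Xle; rewrite Ek in Fge.
  have Xub : X <= k ^+ 2 * y * F.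
    apply: (le_trans Xle); have -> : c * k * (y * m) = k ^+ 2 * y * (c * i * m).
      rewrite (_ : k ^+ 2 * y * (c * i * m) = c * k * (y * m) * (k * i)); last by ring.
      by rewrite ki mulr1.
    by rewrite ler_wpM2l// mulr_ge0// exprn_ge0// ltW.
  have Xlb : i ^+ 2 * y * F <= X.
    apply: le_trans Xge; have -> : c * i * (y * m) = i ^+ 2 * y * (c * k * m).
      rewrite (_ : i ^+ 2 * y * (c * k * m) = c * i * (y * m) * (k * i)); last by ring.
      by rewrite ki mulr1.
    by rewrite ler_wpM2l// mulr_ge0// exprn_ge0// ltW.
  have k2 : 0 <= k ^+ 2 - 1 by rewrite subr_ge0 exprn_ege1.
  have i2 : 1 - i ^+ 2 <= k ^+ 2 - 1.
    rewrite -subr_ge0 (_ : _ - _ = (k - i) ^+ 2 + 2 * (k * i - 1)); last by ring.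
    by rewrite ki subrr mulr0 addr0 sqr_ge0.
  rewrite ler_norml; apply/andP; split.
    rewrite lerNl opprB; apply: (@le_trans _ _ (y * (1 - i ^+ 2))).
      rewrite mulrBr mulr1 lerD2l lerN2 ler_pdivlMr// [y * _]mulrC//.
    by rewrite (le_trans (ler_wpM2l y0 i2))// ler_wpM2r.
  apply: (@le_trans _ _ (y * (k ^+ 2 - 1))); last by rewrite ler_wpM2r.
  by rewrite mulrBr mulr1 lerD2r ler_pdivrMr// [y * _]mulrC.
have -> : z / F - Y / m = (z - X) / F + (X / F - Y / m) by field; rewrite !gt_eqF.
rewrite (le_trans (ler_normD _ _))// lerD// normrM normfV (gtr0_norm F0).
by rewrite ler_pdivrMr// ler_norml; apply/andP; split; lra.
Qed.

(** Each section along the first coordinate has at most one point. In dimension 0 the measure is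
    instead the unit mass at the only vector. *)
Lemma lebesgue_cv_set1 {R : realType} {d : nat} (v : 'cV[R]_d) : (0 < d)%N ->
  lebesgue_cv R d [set v] = 0%E.
Proof.
case: d v => // d v _; rewrite lebesgue_cvS_xsection integral0_eq// => u _.
apply/eqP; rewrite -measure_le0 -(lebesgue_measure_set1 (v ord0 ord0)).
apply: le_measure; rewrite ?inE//=.
  have m1 : measurable [set v].
    apply: compact_measurable_cvector; exact: compact_set1.
  have mcons : measurable (@cvector_cons R d @^-1` [set v]).
    by rewrite -[X in measurable X]setTI; exact: measurable_cvector_cons.
  by have := measurable_xsection u mcons; rewrite cvector_cons_xsection.
by move=> t /= <-; rewrite mxE unlift_none.
Qed.

Section affine_image.
Context {R : realType} {d : nat}.
Variables (A : 'M[R]_d) (b : 'cV[R]_d) (C W : set 'cV[R]_d).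
Hypotheses (Au : A \in unitmx) (mC : measurable C)
  (WE : W = [set b + A *m u | u in C]).

Lemma affine_image_preimage : (fun u => A *m u + b) @^-1` W = C.
Proof.
rewrite WE; apply/seteqP; split=> [u [u' Cu' /=]|u Cu /=]; last first.
  by exists u => //; rewrite addrC.
rewrite addrC => /addIr /(congr1 (mulmx (invmx A))).
by rewrite !mulmxA mulVmx// !mul1mx => <-.
Qed.

Lemma measurable_affine_image : measurable W.
Proof.
have -> : W = (fun v => invmx A *m v + - (invmx A *m b)) @^-1` C.
  rewrite WE; apply/seteqP; split=> [_ [u Cu <-] /=|v Cv /=].
    by rewrite mulmxDr addrAC subrr add0r mulmxA mulVmx// mul1mx.
  exists (invmx A *m v + - (invmx A *m b)) => //.
  by rewrite mulmxDr mulmxN !mulmxA mulmxV// !mul1mx addrC subrK.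
by rewrite -[X in measurable X]setTI; exact: measurable_affine.
Qed.

Lemma lebesgue_cv_affine_image :
  lebesgue_cv R d W = (`|\det A|%:E * lebesgue_cv R d C)%E.
Proof.
by rewrite (lebesgue_cv_affine _ A b)// ?affine_image_preimage//;
   exact: measurable_affine_image.
Qed.

Lemma Rintegral_affine_image (g : 'cV[R]_d -> R) : measurable_fun W g ->
  (forall v, W v -> 0 <= g v) ->
  (lebesgue_cv R d).-integrable C (EFin \o (fun u => g (A *m u + b))) ->
  \int[lebesgue_cv R d]_(v in W) g v =
  `|\det A| * \int[lebesgue_cv R d]_(u in C) g (A *m u + b).
Proof.
move=> mg g0 ig; rewrite -[RHS]RintegralZl// /Rintegral; congr fine.
rewrite (ge0_integral_scaled_pushforward _ (fun u => A *m u + b) `|\det A|)//.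
- by rewrite affine_image_preimage -integralZl.
- exact: measurable_affine.
- by move=> B mB; exact: lebesgue_cv_affine.
- exact: measurable_affine_image.
- exact/measurable_EFinP.
Qed.

End affine_image.

Section spd_square_root.
Context {R : realType} {d : nat}.
Implicit Types (M : 'M[R]_d) (u : 'cV[R]_d).

Lemma spd_sqrtmxP M : (posdefmx (spd_sqrtmx M) /\ spd_sqrtmx M *m spd_sqrtmx M = M) \/
  spd_sqrtmx M = 0.
Proof. by rewrite /spd_sqrtmx; case: xgetP => [S _ []|_]; [left|right]. Qed.

(** If the root takes its default [0], [invmx] returns that noninvertible matrix unchanged; in
    dimension 0, where [0] is invertible, every vector is zero anyway. *)
Lemma inv_sqrtmxP M : (posdefmx (spd_sqrtmx M) /\ spd_sqrtmx M *m spd_sqrtmx M = M) \/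
  forall u, inv_sqrtmx M *m u = 0.
Proof.
have [?|S0] := spd_sqrtmxP M; [by left|right => u].
rewrite /inv_sqrtmx S0; have [U|U] := boolP ((0 : 'M[R]_d) \in unitmx).
  by rewrite -[u]mul1mx -(mulVmx U) mulmx0 mul0mx mulmx0.
by rewrite invmx_out// mul0mx.
Qed.

(** For [v = M^{-1/2} u] the form of [M] at [v] is the squared norm of [u], and it dominates
    [lambda_min M] times that of [v]. *)
Lemma inv_sqrtmx_lambda_min M u : posdefmx M ->
  lambda_min M * sqnorm (inv_sqrtmx M *m u) <= sqnorm u.
Proof.
move=> Mpos; have [[Spos SS]|A0] := inv_sqrtmxP M; last first.
  by rewrite A0 [sqnorm 0]sqnormE mulmx0 mxE mulr0 sqnorm_ge0.
have Su := posdefmx_unitmx _ Spos.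
apply: (le_trans (posdefmx_le_form _ (inv_sqrtmx M *m u) Mpos)).
by rewrite -(sqnorm_sqrtmx _ _ _ Spos SS) mulmxA mulmxV// mul1mx.
Qed.

Lemma enorm_inv_sqrtmx_lt M u (l D : R) : posdefmx M -> 0 < l -> l <= lambda_min M ->
  enorm u <= D -> enorm (inv_sqrtmx M *m u) <= D / Num.sqrt l.
Proof.
move=> Mpos l0 lM uD; rewrite ler_pdivlMr ?sqrtr_gt0//; apply: le_trans uD.
rewrite /enorm -sqrtrM ?sqnorm_ge0// ler_wsqrtr// mulrC.
apply: le_trans (inv_sqrtmx_lambda_min M u Mpos).
by rewrite ler_wpM2r// sqnorm_ge0.
Qed.

End spd_square_root.

Lemma measurable_sqnorm {R : realType} {d : nat} :
  measurable_fun setT (@sqnorm R d).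
Proof.
by apply: measurable_sum => i; apply: measurable_funX; exact: measurable_coord.
Qed.

(** In the error, [delta] comes from the quadratic approximation of the divergence, the middle term
    from the variation of the prior inside the mean, and [ln k] from the same variation inside
    [ln Pi(W)]. *)
Lemma fisher_cell_estimate {R : realType} {d : nat} (d_gt0 : (0 < d)%N)
    (M : 'M[R]_d) (theta0 : 'cV[R]_d) (C W : set 'cV[R]_d) (pi : 'cV[R]_d -> R)
    (h : 'cV[R]_d -> \bar R) (k delta D : R) :
  measurable C -> C 0 -> 0 < vol C -> (forall u, C u -> enorm u <= D) ->
  W = [set theta0 + inv_sqrtmx M *m u | u in C] ->
  measurable_fun W pi -> 0 < pi theta0 -> 1 <= k -> 0 <= delta ->
  (forall theta, W theta -> pi theta0 / k <= pi theta <= pi theta0 * k) ->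
  \int[lebesgue_cv R d]_(theta in W) pi theta != 0 ->
  (forall u, C u ->
     `|h (theta0 + inv_sqrtmx M *m u)%R - (2^-1 * sqnorm u)%:E| <= delta%:E)%E ->
  exists2 y : R,
    ((\int[lebesgue_cv R d]_(theta in W) (pi theta)%:E)^-1 *
     \int[lebesgue_cv R d]_(theta in W) (h theta * (pi theta)%:E) = y%:E)%E &
    `|y - ln (\int[lebesgue_cv R d]_(theta in W) pi theta) -
      (Phi C + (- ln (pi theta0) + 2^-1 * ln (\det M)))| <=
    delta + 2^-1 * D ^+ 2 * (k ^+ 2 - 1) + ln k.
Proof.
move=> mC C0 volC CD WE mpi pi0 k1 delta0 piW PiW hC.
have k0 : 0 < k by apply: lt_le_trans k1.
set A := inv_sqrtmx M in WE hC *.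
have [[Spos SS]|A0] := inv_sqrtmxP M; last first.
  (* Without a square root [inv_sqrtmx M] is 0 and the cell is a null singleton. *)
  have W1 : W = [set theta0].
    rewrite WE; apply/seteqP; split=> [_ [u _ <-]|_ ->] /=; first by rewrite A0 addr0.
    by exists 0; rewrite // A0 addr0.
  move: PiW; rewrite /Rintegral null_set_integral ?eqxx//.
  - by rewrite W1; apply: compact_measurable_cvector; exact: compact_set1.
  - exact/measurable_EFinP.
  - by rewrite W1; exact: lebesgue_cv_set1.
have Su := posdefmx_unitmx _ Spos.
have Au : A \in unitmx by rewrite unitmx_inv.
have detA0 : 0 < \det A by rewrite det_inv invr_gt0; exact: posdefmx_det_gt0.
have Mdet0 : 0 < \det M by rewrite -SS det_mulmx mulr_gt0//; exact: posdefmx_det_gt0.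
have lnA : ln (\det A) = - (2^-1 * ln (\det M)).
  rewrite det_inv (det_sqrtmx _ _ Spos SS) lnV ?posrE ?sqrtr_gt0//.
  by rewrite -powR12_sqrt ?ln_powR// ltW.
have mW : measurable W := measurable_affine_image _ _ _ _ Au mC WE.
have lC : lebesgue_cv R d C = (vol C)%:E.
  rewrite /vol fineK//; move: volC; rewrite /vol.
  by have := measure_ge0 (lebesgue_cv R d) C; case: (lebesgue_cv R d C) => //=; rewrite ltxx.
pose m := \det A * vol C.
have m0 : 0 < m by rewrite mulr_gt0.
have lW : lebesgue_cv R d W = m%:E.
  by rewrite (lebesgue_cv_affine_image _ _ _ _ Au mC WE) lC gtr0_norm.
pose B := 2^-1 * D ^+ 2.
have sqB u : C u -> 0 <= 2^-1 * sqnorm u <= B.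
  move=> /CD uD; rewrite mulr_ge0 ?sqnorm_ge0//= ler_wpM2l//.
  rewrite -[leLHS]sqr_sqrtr ?sqnorm_ge0// ler_sqr ?nnegrE ?sqrtr_ge0//.
  by rewrite (le_trans _ uD) ?sqrtr_ge0.
(* The quadratic [|u|^2 / 2] in the original coordinate [theta]; the affine map inside makes it
   measurable on the whole space. *)
pose s theta := 2^-1 * sqnorm (spd_sqrtmx M *m theta + - (spd_sqrtmx M *m theta0)).
have sE u : s (A *m u + theta0) = 2^-1 * sqnorm u.
  by rewrite /s mulmxDr addrK mulmxA mulmxV// mul1mx.
have Wu theta : W theta -> exists2 u, C u & theta = A *m u + theta0.
  by rewrite WE => -[u Cu <-]; exists u; rewrite // addrC.
have ms : measurable_fun setT s.
  apply: measurable_funM => //; apply: measurableT_comp; first exact: measurable_sqnorm.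
  exact: measurable_affine.
have [|theta /Wu[u Cu ->]|theta /Wu[u Cu ->]|Pige Pile [y yE yH]] :=
  @weighted_mean_estimate _ _ R (lebesgue_cv R d) W pi s h (pi theta0) k B delta m
  mW lW m0 mpi _ pi0 k1 delta0 piW.
- exact: measurable_funTS.
- by rewrite sE; exact: sqB.
- by rewrite sE (addrC (A *m u)); exact: hC.
exists y => //.
set Pi := Rintegral _ _ _ in Pige Pile *.
have Pi0 : 0 < Pi by apply: lt_le_trans Pige; rewrite mulr_gt0// divr_gt0.
have sqint : (lebesgue_cv R d).-integrable C (EFin \o @sqnorm R d).
  apply: measurable_bounded_integrable => //; first by rewrite lC ltry.
    by apply: measurable_funTS; exact: measurable_sqnorm.
  exists (2 * B); split => [|x Bx u Cu]; first exact: num_real.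
  rewrite /= ger0_norm ?sqnorm_ge0// (le_trans _ (ltW Bx))//.
  by have /andP[_ ] := sqB _ Cu; lra.
(* The Jacobian [\det A] occurs in the integral over [W] and in its volume [m], and cancels. *)
have meanE : \int[lebesgue_cv R d]_(theta in W) s theta / m =
    (2 * vol C)^-1 * \int[lebesgue_cv R d]_(u in C) sqnorm u.
  rewrite (Rintegral_affine_image _ _ _ _ Au mC WE)//.
  - under eq_Rintegral do rewrite sE.
    rewrite RintegralZl// gtr0_norm// /m; field.
    by rewrite !gt_eqF.
  - exact: measurable_funTS.
  - by move=> theta /Wu[u Cu ->]; rewrite sE mulr_ge0 ?sqnorm_ge0.
  - rewrite (_ : (fun u => s (A *m u + theta0)) = fun u => 2^-1 * sqnorm u).
      exact: (integrableZl mC _ sqint).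
    by apply/funext => u; rewrite sE.
rewrite meanE in yH.
have lnPi : `|ln Pi - (ln (pi theta0) + ln m)| <= ln k.
  rewrite ler_norml; apply/andP; split.
    have : ln (pi theta0 / k * m) <= ln Pi by rewrite ler_ln ?posrE// mulr_gt0 ?divr_gt0.
    by rewrite lnM ?posrE ?divr_gt0// ln_div ?posrE//; lra.
  have : ln Pi <= ln (pi theta0 * k * m) by rewrite ler_ln ?posrE// !mulr_gt0.
  by rewrite lnM ?posrE ?mulr_gt0// lnM ?posrE//; lra.
have lnm : ln m = - (2^-1 * ln (\det M)) + ln (vol C).
  by rewrite /m lnM ?posrE// lnA.
rewrite /Phi; set H := (2 * vol C)^-1 * _ in yH *.
rewrite lnm in lnPi.
have -> : y - ln Pi - (- ln (vol C) + H + (- ln (pi theta0) + 2^-1 * ln (\det M))) =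
  (y - H) - (ln Pi - (ln (pi theta0) + (- (2^-1 * ln (\det M)) + ln (vol C)))) by ring.
by rewrite (le_trans (ler_normB _ _))// lerD.
Qed.

(** * Codelength identity and choice of constants *)

Lemma codelength_expect {dT} {T : measurableType dT} {R : realType} {d : nat}
    (nu : {measure set T -> \bar R}) (p : 'cV[R]_d -> T -> R) (r : T -> \bar R)
    (B : codebook T R d) (t : T -> 'cV[R]_d) (Delta : 'I_(ncells B) -> R) :
  measurable_partition (cell B) -> measurable_fun setT r -> (forall x, 0 <= r x)%E ->
  (forall j, measurable_fun setT (neglog (p (assertion B j)))) ->
  measurable_fun setT (fun x => neglog (p (t x)) x) ->
  (forall j, 0 < weight B j /\ ((weight B j)%:E = \int[nu]_(x in cell B j) r x)%E) ->
  (forall j, cond_expect nu r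
     (fun x => neglog (p (assertion B j)) x - neglog (p (t x)) x)%E (cell B j) =
     (Delta j)%:E) ->
  codelength nu p r B = (expect nu r (fun x => neglog (p (t x)) x) +
    (\sum_j weight B j * (Delta j - ln (weight B j)))%:E)%E.
Proof.
move=> partB mr r0 ma mt wB DeltaE; have [mB _ _] := partB.
rewrite /codelength /expect (integral_measurable_partition _ _ _ _ partB); last first.
  exact: emeasurable_funM.
rewrite (eq_bigr (fun j => \int[nu]_(x in cell B j) (r x * neglog (p (t x)) x) +
    (weight B j * Delta j)%:E)%E) => [|j _]; last first.
  have [w0 wE] := wB j; apply: integral_mule_sub => //; try exact: measurable_funTS.
  - by move=> x; exact: neglog_neqNy.
  - by move=> x; exact: neglog_neqNy.
  - exact: DeltaE.
rewrite big_split/= sumEFin addeCA -EFinD; congr (_ + _%:E)%E.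
rewrite addrC -sumrB; apply: eq_bigr => j _; ring.
Qed.

(** With [m] a positive lower bound of [f], the additive tolerance [(k - 1) m] is at most
    [(k - 1) f y], hence a multiplicative one; the lower bound follows by exchanging [x] and [y]. *)
Lemma compact_positive_ratio {R : realType} {d : nat} (K : set 'cV[R]_d)
    (f : 'cV[R]_d -> R) (k : R) : compact K -> {within K, continuous f} ->
  (forall x, K x -> 0 < f x) -> 1 < k ->
  exists2 r : R, 0 < r & forall x y, K x -> K y -> `|x - y| < r ->
    f y / k <= f x <= f y * k.
Proof.
move=> cK cf f0 k1; have k0 : 0 < k by apply: lt_trans k1.
have [K0|/set0P K0] := eqVneq K set0; first by exists 1 => // x y; rewrite K0.
have [m m0 fm] := compact_positive_bounds _ _ cK K0 cf f0.
have e0 : 0 < (k - 1) * m by rewrite mulr_gt0// subr_gt0.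
have [r r0 rP] := compact_uniformly_continuous _ _ cK cf _ e0.
have le x y : K x -> K y -> `|x - y| < r -> f x <= f y * k.
  move=> Kx Ky /(rP _ _ Kx Ky) /ltr_normlW fxy.
  have : (k - 1) * m <= (k - 1) * f y by rewrite ler_wpM2l ?fm// subr_ge0 ltW.
  by rewrite mulrBl mul1r mulrC; lra.
exists r => // x y Kx Ky xy; rewrite le// ler_pdivrMr// le//.
by rewrite distrC.
Qed.

(** For [k = 1 + t] with [t <= 1], one has [k^2 - 1 <= 3 t] and [ln k <= t], so the total is at most
    [t (3 B + 1)]. *)
Lemma small_ratio {R : realType} (B e : R) : 0 <= B -> 0 < e ->
  exists2 k : R, 1 < k & B * (k ^+ 2 - 1) + ln k <= e.
Proof.
move=> B0 e0; pose t := Num.min 1 (e / (3 * B + 1)).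
have B1 : 0 < 3 * B + 1 by lra.
have t0 : 0 < t by rewrite lt_min ltr01 divr_gt0.
have t1 : t <= 1 by rewrite ge_min lexx.
have te : t * (3 * B + 1) <= e by rewrite -ler_pdivlMr// ge_min lexx orbT.
exists (1 + t); first by rewrite ltrDl.
have lnt : ln (1 + t) <= t by apply: le_ln1Dx; lra.
have tt : t * t <= t by rewrite -[leRHS]mulr1 ler_pM2l.
have : B * ((1 + t) ^+ 2 - 1) <= B * (3 * t).
  by rewrite ler_wpM2l// expr2; lra.
move: te; rewrite mulrDr mulr1 mulrA (mulrC t 3) -(mulrA 3) (mulrC t B); lra.
Qed.

(* All hypotheses on the sequence are for sample sizes n >= 1. *)
Theorem theorem3p1
  (R : realType) (d : nat) (d_gt0 : (0 < d)%N)
  (dX : measure_display) (X : measurableType dX)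
  (Theta : set 'cV[R]_d) (Theta_open : open Theta)
  (* the model *)
  (nu : forall n, {sigma_finite_measure set (n.-tuple X) -> \bar R})
  (P : forall n, 'cV[R]_d -> probability (n.-tuple X) R)
  (p : forall n, 'cV[R]_d -> n.-tuple X -> R)
  (p_density : forall n theta, (0 < n)%N -> Theta theta ->
     has_density (nu n) (P n theta) (p n theta))
  (p_measurable : forall n, (0 < n)%N ->
     measurable_fun (Theta `*` setT)
       (fun y : 'cV[R]_d * n.-tuple X => p n y.1 y.2))
  (J : nat -> 'cV[R]_d -> 'M[R]_d)
  (J_fisher : forall n theta, (0 < n)%N -> Theta theta ->
     is_fisher_information (P n theta) (p n) theta (J n theta))
  (* the prior *)
  (K : set 'cV[R]_d) (K_compact : compact K) (K_sub : K `<=` Theta)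
  (pi : 'cV[R]_d -> R) (pi_cont : {within K, continuous pi})
  (pi_gt0 : forall theta, K theta -> 0 < pi theta)
  (pi_density : (\int[lebesgue_cv R d]_(theta in K) (pi theta)%:E = 1)%E)
  (* the codebooks and the unquantised estimates *)
  (cb : forall n, codebook (n.-tuple X) R d)
  (cb_partition : forall n, (0 < n)%N -> measurable_partition (cell (cb n)))
  (cb_weight : forall n (j : 'I_(ncells (cb n))), (0 < n)%N ->
     0 < weight (cb n) j /\
     ((weight (cb n) j)%:E =
       \int[nu n]_(x in cell (cb n) j) mixture (p n) K pi x)%E)
  (cb_assertion : forall n (j : 'I_(ncells (cb n))), (0 < n)%N ->
     K (assertion (cb n) j))
  (T : forall n, n.-tuple X -> 'cV[R]_d)
  (T_measurable : forall n, (0 < n)%N -> measurable_fun setT (T n))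
  (T_in : forall n x, (0 < n)%N -> K (T n x))
  (* A1 *)
  (J_cont : forall n, (0 < n)%N -> {within K, continuous (J n)})
  (J_posdef : forall n theta, (0 < n)%N -> K theta -> posdefmx (J n theta))
  (J_lambda : inf [set lambda_min (J n theta) | theta in K]
     @[n --> \oo] --> +oo)
  (* A2 *)
  (KL_quadratic : forall B : set 'cV[R]_d, B !=set0 -> bounded_set B ->
     ereal_sup [set `|KL (P n (tu.1 + inv_sqrtmx (J n tu.1) *m tu.2)%R) (P n tu.1)
                      - (2^-1 * sqnorm tu.2)%:E|%E | tu in K `*` B]
     @[n --> \oo] --> 0%E)
  (* A3 *)
  (W C : forall n, 'I_(ncells (cb n)) -> set 'cV[R]_d)
  (W_sub : forall n j, (0 < n)%N -> W n j `<=` K)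
  (alpha : forall n, 'I_(ncells (cb n)) -> R)
  (weightE : forall n j, (0 < n)%N ->
     weight (cb n) j =
       (\int[lebesgue_cv R d]_(theta in W n j) pi theta) * expR (alpha n j))
  (alpha_o : \sum_j weight (cb n) j * `|alpha n j| @[n --> \oo] --> (0 : R))
  (WE : forall n j, (0 < n)%N ->
     W n j = [set assertion (cb n) j +
                  inv_sqrtmx (J n (assertion (cb n) j)) *m u | u in C n j])
  (C_measurable : forall n j, (0 < n)%N -> measurable (C n j))
  (C0 : forall n j, (0 < n)%N -> C n j 0)
  (C_vol : forall n j, (0 < n)%N -> 0 < vol (C n j))
  (C_diam : exists D : R, forall n j, (0 < n)%N ->
     forall u v, C n j u -> C n j v -> enorm (u - v) <= D)
  (* A4 *)
  (eps : forall n, 'I_(ncells (cb n)) -> R)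
  (DeltaE : forall n j, (0 < n)%N ->
     (cond_expect (nu n) (mixture (p n) K pi)
        (fun x => neglog (p n (assertion (cb n) j)) x
                  - neglog (p n (T n x)) x) (cell (cb n) j)
      = (\int[lebesgue_cv R d]_(theta in W n j) (pi theta)%:E)^-1
        * \int[lebesgue_cv R d]_(theta in W n j)
            (KL (P n theta) (P n (assertion (cb n) j)) * (pi theta)%:E)
        + (eps n j)%:E)%E)
  (eps_o : \sum_j weight (cb n) j * `|eps n j| @[n --> \oo] --> (0 : R))
  (* A5 *)
  (Phi_lim : \sum_j weight (cb n) j * Phi (C n j) @[n --> \oo] -->
     d%:R / 2 * ln (kappa_opt R d) + d%:R / 2)
  (* A6 *)
  (phi_lim :
     let phi n theta := - ln (pi theta) + 2^-1 * ln (\det (J n theta)) in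
     \sum_j weight (cb n) j * phi n (assertion (cb n) j)
       - \int[lebesgue_cv R d]_(theta in K) (phi n theta * pi theta)
     @[n --> \oo] --> (0 : R)) :
  let E n := expect (nu n) (mixture (p n) K pi)
               (fun x => neglog (p n (T n x)) x) in
  let h := - \int[lebesgue_cv R d]_(theta in K) (pi theta * ln (pi theta)) in
  let I_ASMML n := codelength (nu n) (p n) (mixture (p n) K pi) (cb n) in
  (exists2 e : nat -> R, e @ \oo --> (0 : R) &
     \forall n \near \oo,
       I_ASMML n =
         (E n + (h + 2^-1 * \int[lebesgue_cv R d]_(theta in K)
                              (pi theta * ln (\det (J n theta)))
                 + d%:R / 2 * ln (kappa_opt R d) + d%:R / 2 + e n)%:E)%E) /\
  (forall (nu1 : {sigma_finite_measure set X -> \bar R})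
     (P1 : 'cV[R]_d -> probability X R) (p1 : 'cV[R]_d -> X -> R)
     (I : 'cV[R]_d -> 'M[R]_d),
     (forall theta, Theta theta ->
        has_density nu1 (P1 theta) (p1 theta) /\
        is_fisher_information (P1 theta) p1 theta (I theta)) ->
     (forall n theta, (0 < n)%N -> Theta theta ->
        iid_law (P n theta) (P1 theta)) ->
     (forall n theta, (0 < n)%N -> Theta theta ->
        J n theta = n%:R *: I theta) ->
     exists2 e : nat -> R, e @ \oo --> (0 : R) &
       \forall n \near \oo,
         I_ASMML n =
           (E n + (d%:R / 2 * ln n%:R + h
                   + 2^-1 * \int[lebesgue_cv R d]_(theta in K)
                              (pi theta * ln (\det (I theta)))
                   + d%:R / 2 * ln (kappa_opt R d) + d%:R / 2 + e n)%:E)%E).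
Proof.
move=> E h I_ASMML.
have mK := compact_measurable_cvector _ K_compact.
have mpi := continuous_measurable_cvector _ _ mK pi_cont.
pose L5 := d%:R / 2 * ln (kappa_opt R d) + d%:R / 2.
pose phi n theta := - ln (pi theta) + 2^-1 * ln (\det (J n theta)).
pose c n := h + 2^-1 * \int[lebesgue_cv R d]_(theta in K) (pi theta * ln (\det (J n theta)))
  + d%:R / 2 * ln (kappa_opt R d) + d%:R / 2.
pose avg n (j : 'I_(ncells (cb n))) :=
  ((\int[lebesgue_cv R d]_(theta in W n j) (pi theta)%:E)^-1
   * \int[lebesgue_cv R d]_(theta in W n j)
       (KL (P n theta) (P n (assertion (cb n) j)) * (pi theta)%:E))%E.
pose Delta n j := fine (avg n j) + eps n j.
pose S n := \sum_j weight (cb n) j * (Delta n j - ln (weight (cb n) j)).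
(* The error is defined so that the expansion holds exactly as soon as the averages [avg n j] are
   finite; what remains is its convergence to 0. *)
pose e n := S n - c n.
have estimate (e0 : R) : 0 < e0 -> \forall n \near \oo, (0 < n)%N /\ forall j,
    avg n j \is a fin_num /\
    `|fine (avg n j) - ln (\int[lebesgue_cv R d]_(theta in W n j) pi theta) -
      (Phi (C n j) + phi n (assertion (cb n) j))| <= e0.
  move=> e0_gt0; have [D CD] := C_diam; have e2 : 0 < e0 / 2 by rewrite divr_gt0.
  (* The origin belongs to every [C n j], so the diameter bound is a bound on norms; the [+ 1] makes
     it positive. *)
  pose D' := `|D| + 1; have D'0 : 0 < D' by rewrite ltr_wpDl.
  have CD' n j u : (0 < n)%N -> C n j u -> enorm u <= D'.
    move=> n0 Cu; have := CD n j n0 u 0 Cu (C0 n j n0); rewrite subr0 => /le_trans; apply.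
    by rewrite (le_trans (ler_norm D))// lerDl.
  have B'0 : 0 <= 2^-1 * D' ^+ 2 by rewrite mulr_ge0// sqr_ge0.
  have [k k1 kB] := small_ratio _ _ B'0 e2.
  have [r r0 piratio] := compact_positive_ratio _ _ _ K_compact pi_cont pi_gt0 k1.
  (* Chosen so that [D' / sqrt l = r / 2]: once [lambda_min >= l], every cell lies within [r] of its
     assertion, where the prior varies by a factor at most [k]. *)
  pose l := (D' / (r / 2)) ^+ 2.
  have l0 : 0 < l by rewrite exprn_gt0// !divr_gt0.
  pose Bset := [set u : 'cV[R]_d | enorm u <= D'].
  have B0 : Bset !=set0.
    by exists 0; rewrite /Bset /= /enorm sqnormE mulmx0 mxE sqrtr0 ltW.
  have Bbnd : bounded_set Bset.
    exists D'; split => [|x D'x u Bu]; first exact: num_real.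
    exact: le_trans (normr_le_enorm u) (le_trans Bu (ltW D'x)).
  have KLlt : \forall n \near \oo,
      (ereal_sup [set `|KL (P n (tu.1 + inv_sqrtmx (J n tu.1) *m tu.2)%R) (P n tu.1)
         - (2^-1 * sqnorm tu.2)%:E|%E | tu in K `*` Bset] < (e0 / 2)%:E)%E.
    apply: (KL_quadratic Bset B0 Bbnd [set x | (x < (e0 / 2)%:E)%E]).
    by apply: open_nbhs_nbhs; split; [exact: open_ereal_lt_ereal|rewrite /= lte_fin].
  have lamge : \forall n \near \oo, l <= inf [set lambda_min (J n theta) | theta in K].
    by move/cvgryPge: J_lambda; exact.
  near=> n; have n0 : (0 < n)%N by near: n; exact: nbhs_infty_gt.
  split => // j.
  pose th := assertion (cb n) j; have Kth : K th by exact: cb_assertion.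
  have [w0 wE] := cb_weight n j n0.
  have Pi0 : 0 < \int[lebesgue_cv R d]_(theta in W n j) pi theta.
    by move: w0; rewrite weightE// pmulr_lgt0// expR_gt0.
  have Jpos := J_posdef n th n0 Kth.
  have lth : l <= lambda_min (J n th).
    apply: le_trans (near lamge n _) _ => //; apply: ge_inf; last by exists th.
    by exists 0 => _ [th' Kth' <-]; apply: lambda_min_ge0; exact: J_posdef.
  have piW theta : W n j theta -> pi th / k <= pi theta <= pi th * k.
    move=> Wtheta; apply: piratio => //; first exact: (W_sub n j n0).
    move: Wtheta; rewrite WE// => -[u Cu <-]; rewrite addrC addKr.
    apply: le_lt_trans (normr_le_enorm _) _.
    apply: le_lt_trans (enorm_inv_sqrtmx_lt _ u l D' Jpos l0 lth (CD' _ _ _ n0 Cu)) _.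
    rewrite /l sqrtr_sqr gtr0_norm ?divr_gt0// invfM invrK mulrA divff ?gt_eqF//.
    by rewrite mul1r gtr_pMr// invf_lt1// ltr1n.
  have KLC u : C n j u ->
      (`|KL (P n (th + inv_sqrtmx (J n th) *m u)%R) (P n th) - (2^-1 * sqnorm u)%:E|
        <= (e0 / 2)%:E)%E.
    move=> Cu; apply/ltW; apply: le_lt_trans (near KLlt n _) => //.
    apply: ereal_sup_ubound; exists (th, u) => //; split => //=.
    exact: CD' Cu.
  have mpiW : measurable_fun (W n j) pi.
    by apply: (measurable_funS mK _ mpi); exact: W_sub.
  have [y yE yle] := @fisher_cell_estimate R d d_gt0 (J n th) th (C n j) (W n j) pi
    (fun theta => KL (P n theta) (P n th)) k (e0 / 2) D' (C_measurable n j n0) (C0 n j n0)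
    (C_vol n j n0) (fun u => CD' n j u n0) (WE n j n0) mpiW (pi_gt0 th Kth) (ltW k1)
    (ltW e2) piW (lt0r_neq0 Pi0) KLC.
  rewrite /avg -/th yE; split=> //=; apply: (le_trans yle).
  by rewrite -addrA [leRHS](splitr e0) lerD2l.
have SE n : (0 < n)%N -> (forall j, avg n j \is a fin_num) ->
    I_ASMML n = (E n + (S n)%:E)%E.
  move=> n0 fin; apply: codelength_expect => //.
  - exact: cb_partition.
  - exact: (measurable_mixture (nu n) (P n) (p n) Theta K pi (fun theta => p_density n theta n0)
      (p_measurable n n0)).
  - exact: (mixture_ge0 (nu n) (P n) (p n) Theta K pi (fun theta => p_density n theta n0)).
  - move=> j; apply: measurable_neglog.
    by have [] := p_density n _ n0 (K_sub _ (cb_assertion n j n0)).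
  - exact: (measurable_neglog_estimate (p n) Theta K (p_measurable n n0)
      Theta_open K_sub (T n) (T_measurable n n0) (fun x => T_in n x n0)).
  - by move=> j; exact: cb_weight.
  - by move=> j; rewrite DeltaE// -/(avg n j) /Delta EFinD fineK.
have sumq n : (0 < n)%N -> \sum_j weight (cb n) j = 1.
  move=> n0; apply: EFin_inj; rewrite -sumEFin.
  rewrite -(integral_mixture (nu n) (P n) (p n) Theta K pi (fun theta => p_density n theta n0)
    (p_measurable n n0) Theta_open K_compact K_sub pi_cont pi_gt0 pi_density).
  rewrite (integral_measurable_partition _ _ _ _ (cb_partition n n0)); last first.
    exact: (measurable_mixture (nu n) (P n) (p n) Theta K pi (fun theta => p_density n theta n0)
      (p_measurable n n0)).
  by apply: eq_bigr => j _; have [] := cb_weight n j n0.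
have detJ0 n theta : (0 < n)%N -> K theta -> 0 < \det (J n theta).
  by move=> n0 Kt; apply: posdefmx_det_gt0; exact: J_posdef.
have ilndet n : (0 < n)%N -> (lebesgue_cv R d).-integrable K
    (EFin \o (fun theta => pi theta * ln (\det (J n theta)))).
  move=> n0; apply: compact_integrable_mul_ln => //; last by move=> theta; exact: detJ0.
  exact/within_det_continuous/J_cont.
have ilnpi : (lebesgue_cv R d).-integrable K (EFin \o (fun theta => pi theta * ln (pi theta))).
  exact: compact_integrable_mul_ln.
(* The claimed constant is exactly the limit in (A5) plus the integral in (A6). *)
have cE n : (0 < n)%N ->
    c n = \int[lebesgue_cv R d]_(theta in K) (phi n theta * pi theta) + L5.
  move=> n0; rewrite /c /L5 /h addrA; congr (_ + _ + _).
  rewrite -mulN1r -!RintegralZl//; last exact: ilndet.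
  rewrite -RintegralD//; last 2 first.
  - exact: (integrableZl mK _ ilnpi).
  - exact: (integrableZl mK _ (ilndet n n0)).
  by apply: eq_Rintegral => theta _; rewrite /phi; ring.
(* What (A5) and (A6) do not control: the uniform cell error together with the [eps] and [alpha]
   terms. *)
pose rem n := S n - \sum_j weight (cb n) j * Phi (C n j)
  - \sum_j weight (cb n) j * phi n (assertion (cb n) j).
have remainder (e0 : R) : 0 < e0 -> \forall n \near \oo, (0 < n)%N /\ `|rem n| <=
    e0 + \sum_j weight (cb n) j * `|eps n j| + \sum_j weight (cb n) j * `|alpha n j|.
  move=> e0_gt0; apply: filterS (estimate e0 e0_gt0) => n [n0 est].
  split => //; rewrite /rem -!sumrB -[X in X + _ + _]mulr1 -(sumq n n0) mulr_sumr.
  rewrite (_ : _ + _ + _ = \sum_j (e0 * weight (cb n) j + weight (cb n) j * `|eps n j|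
    + weight (cb n) j * `|alpha n j|)); last by rewrite !big_split.
  apply: le_trans (ler_norm_sum _ _ _) _; apply: ler_sum => j _.
  have [w0 _] := cb_weight n j n0; have [_ estj] := est j.
  have PiE := weightE n j n0.
  have Pi0 : 0 < \int[lebesgue_cv R d]_(theta in W n j) pi theta.
    by move: w0; rewrite PiE pmulr_lgt0// expR_gt0.
  have lnw : ln (weight (cb n) j) =
      ln (\int[lebesgue_cv R d]_(theta in W n j) pi theta) + alpha n j.
    by rewrite PiE lnM ?posrE ?expR_gt0// expRK.
  rewrite -!mulrBr normrM (gtr0_norm w0) mulrC [e0 * _]mulrC -!mulrDr mulrC ler_pM2l//.
  rewrite /Delta lnw; set a := fine _ in estj *; set b := ln (Rintegral _ _ _) in estj *.
  have -> : a + eps n j - (b + alpha n j) - Phi (C n j) - phi n (assertion (cb n) j) =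
    (a - b - (Phi (C n j) + phi n (assertion (cb n) j))) + eps n j - alpha n j by ring.
  apply: le_trans (ler_normB _ _) _; rewrite lerD2r.
  by apply: le_trans (ler_normD _ _) _; rewrite lerD2r.
have e_cvg : e @ \oo --> (0 : R).
  (* Five contributions: the uniform cell error, [alpha], [eps], and the errors in (A5) and (A6). *)
  apply/cvgr0Pnorm_lt => e0 e0_gt0; have e5 : 0 < e0 / 5 by rewrite divr_gt0.
  near=> n.
  have [n0] : (0 < n)%N /\ `|rem n| <= e0 / 5 + \sum_j weight (cb n) j * `|eps n j|
    + \sum_j weight (cb n) j * `|alpha n j| by near: n; exact: remainder.
  rewrite /rem => remn.
  have : `|\sum_j weight (cb n) j * `|alpha n j| | < e0 / 5.
    by near: n; apply: cvgr0_norm_lt.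
  move/ltr_normlW => Ha.
  have : `|\sum_j weight (cb n) j * `|eps n j| | < e0 / 5.
    by near: n; apply: cvgr0_norm_lt.
  move/ltr_normlW => He.
  have HPhi : `|\sum_j weight (cb n) j * Phi (C n j) - L5| < e0 / 5.
    by near: n; apply: cvgr_distC_lt.
  have Hphi : `|\sum_j weight (cb n) j * phi n (assertion (cb n) j)
      - \int[lebesgue_cv R d]_(theta in K) (phi n theta * pi theta)| < e0 / 5.
    by near: n; apply: cvgr0_norm_lt.
  rewrite /e (cE n n0).
  move: remn Ha He HPhi Hphi; set s1 := \sum_j _ * Phi _; set s2 := \sum_j _ * phi _ _.
  set s3 := \sum_j _ * `|eps _ _|; set s4 := \sum_j _ * `|alpha _ _|.
  set s5 := Rintegral _ _ _; rewrite ler_norml !ltr_norml.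
  move=> /andP[? ?] ? ? /andP[? ?] /andP[? ?]; apply/andP; split; lra.
have near_exact : \forall n \near \oo, I_ASMML n = (E n + (c n + e n)%:E)%E.
  (* The tolerance 1 is arbitrary: only the finiteness of the averages is used. *)
  apply: filterS (estimate 1 ltr01) => n [n0 fin].
  by rewrite SE// => [|j]; [rewrite /e subrKC|have [] := fin j].
split; first by exists e => //; near do rewrite addrA.
move=> nu1 P1 p1 I _ _ JE; exists e => //.
near=> n; have n0 : (0 < n)%N by near: n; exact: nbhs_infty_gt.
rewrite (near near_exact n)//; congr (_ + (_ + _)%:E)%E.
have JnE theta : K theta -> ln (\det (J n theta)) = d%:R * ln n%:R + ln (\det (I theta)).
  (* Since [J 1 = I] on [K], positivity of [\det (I theta)] is read off at sample size 1; the factor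
     [n^d] of the determinant then yields [d ln n]. *)
  move=> Kt; have := detJ0 1%N theta isT Kt; rewrite !JE//; [|exact: K_sub|exact: K_sub].
  rewrite scale1r => detI0; rewrite detZ lnM ?posrE ?exprn_gt0 ?ltr0n//.
  by rewrite lnXn ?ltr0n// mulr_natl.
rewrite /c -!addrA [RHS]addrCA; congr (_ + _).
rewrite [in RHS]addrA; congr (_ + _).
have -> : \int[lebesgue_cv R d]_(theta in K) (pi theta * ln (\det (J n theta))) =
    d%:R * ln n%:R + \int[lebesgue_cv R d]_(theta in K) (pi theta * ln (\det (I theta))).
  have ipi : (lebesgue_cv R d).-integrable K (EFin \o pi).
    apply: fin_num_integral_integrable => //; first exact/measurable_EFinP.
    by rewrite pi_density.
  have iI : (lebesgue_cv R d).-integrable K (EFin \o (fun theta => pi theta * ln (\det (I theta)))).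
    apply: eq_integrable (ilndet 1%N isT) => // theta /set_mem Kt /=.
    by rewrite JE ?scale1r//; exact: K_sub.
  have <- : d%:R * ln n%:R * \int[lebesgue_cv R d]_(theta in K) pi theta = d%:R * ln n%:R.
    by rewrite /Rintegral pi_density mulr1.
  rewrite -RintegralZl// -RintegralD//; last exact: (integrableZl mK _ ipi).
  by apply: eq_Rintegral => theta /set_mem Kt; rewrite JnE//; ring.
by rewrite mulrDr; congr (_ + _); ring.
Unshelve. all: by end_near.
Qed.
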